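(* In the setting described in the context (constant disturbance $w_t=w$ for all $t$), let the two-point direct search for equilibrium selection be run with probing ratios $\delta_t=1/\sqrt{t+1}$ for even $t\ge0$. Let $\bar c_0,\bar c_b\ge0$ and $\rho\in(0,1)$ be constants such that, for all even $t\ge0$, $$\mathbb{E}\big[b_t^{\mathrm{fo}}(u_t)\big]+\mathbb{E}\big[b_{t+1}^{\mathrm{fo}}(u_{t+1})\big]\le\bar c_0\,\rho^{t/2}+\bar c_b\,\delta_t ,$$ and fix $\varepsilon>0$ such that $$\varepsilon\ge16\,\bar c_b(\sqrt2+1)\sqrt{2\pi p}.$$ Then, for any even integer $T\ge2$ satisfying both $$T\ge\max\Big\{\frac{2\pi p(\sqrt2+1)^2}{\varepsilon^2}\big(4(\Phi(u_0)-\Phi_{\mathrm{low}})+L\big)^2,\ \frac{8\pi p(\sqrt2+1)^2L^2}{\varepsilon^2}\log^2\Big(\frac{2(\sqrt2+1)\sqrt{2\pi p}\,L}{\varepsilon}\Big)\Big\}$$ and $$T\ge\Big(\frac{8(\sqrt2+1)\sqrt{2\pi p}\,\bar c_0}{(1-\sqrt\rho)\,\varepsilon}\Big)^2,$$ the iterates satisfy $$\min_{t\in[T]_2}\mathbb{E}\big[\|\nabla\Phi(u_t)\|\big]\le\varepsilon .$$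
   Context: $\|\cdot\|$ is the Euclidean norm; $\log$ is the natural logarithm; for even $T\ge2$, $[T]_2=\{0,2,\dots,T-2\}$. Plant with constant disturbance $w\in\mathbb{R}^r$: $x_{t+1}=f(x_t,u_t,w)$, $y_{t+1}=h(x_{t+1},w)$, with $x_t\in\mathbb{R}^n$, $u_t\in\mathbb{R}^p$, $y_t\in\mathbb{R}^q$. There are constants $L_{f,x}\in(0,1)$ and $L_{f,u},L_{f,w},L_{h,x},L_{h,w}\ge0$ such that, for all $x,\bar x,u,\bar u,w,\bar w$: $\|f(x,u,w)-f(\bar x,u,w)\|\le L_{f,x}\|x-\bar x\|$, $\|f(x,u,w)-f(x,\bar u,w)\|\le L_{f,u}\|u-\bar u\|$, $\|f(x,u,w)-f(x,u,\bar w)\|\le L_{f,w}\|w-\bar w\|$, $\|h(x,w)-h(\bar x,w)\|\le L_{h,x}\|x-\bar x\|$, $\|h(x,w)-h(x,\bar w)\|\le L_{h,w}\|w-\bar w\|$. Steady-state maps: $x_{\mathrm{ss}}(u,w)$ is the unique solution of $f(x_{\mathrm{ss}}(u,w),u,w)=x_{\mathrm{ss}}(u,w)$, and $y_{\mathrm{ss}}(u,w)=h(x_{\mathrm{ss}}(u,w),w)$. Cost: $\Psi:\mathbb{R}^p\times\mathbb{R}^q\to\mathbb{R}$ is $L_{\Psi,y}$-Lipschitz in its second argument, uniformly in the first. The reduced cost $\Phi(u)=\Psi(u,y_{\mathrm{ss}}(u,w))$ is differentiable with $L$-Lipschitz gradient ($L>0$) and bounded below by $\Phi_{\mathrm{low}}\in\mathbb{R}$.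 The map $u\mapsto\Psi(u,h(f(x,u,w),w))$ is continuous for every $x\in\mathbb{R}^n$. Two-point direct search for equilibrium selection: given deterministic $u_0\in\mathbb{R}^p$, $x_0\in\mathbb{R}^n$ and probing ratios $\delta_t$, for $t=0,2,4,\dots$: apply $u_t$, giving $x_{t+1}=f(x_t,u_t,w)$, $y_{t+1}=h(x_{t+1},w)$; draw $v_t\sim\mathcal{N}(0,\frac1pI_p)$ independently of all previous draws and set $u_{t+1}=u_t+\delta_tv_t$; apply $u_{t+1}$, giving $x_{t+2}=f(x_{t+1},u_{t+1},w)$, $y_{t+2}=h(x_{t+2},w)$; set $u_{t+2}=u_{t+1}$ if $\Psi(u_{t+1},y_{t+2})\le\Psi(u_t,y_{t+1})$, and $u_{t+2}=u_t$ otherwise. $\mathbb{E}$ is expectation over the random directions. Oracle error along the trajectory: $b_t^{\mathrm{fo}}(u_t)=|\Psi(u_t,y_{t+1})-\Phi(u_t)|$ for every $t\ge0$ (even or odd). *)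

(* Defs.v *)
From HB Require Import structures.
From mathcomp Require Import all_boot all_order all_algebra.
From mathcomp Require Import all_classical all_reals all_analysis.

Set Implicit Arguments.
Unset Strict Implicit.
Unset Printing Implicit Defensive.

Import Order.TTheory GRing.Theory Num.Theory.
Import numFieldNormedType.Exports.

Local Open Scope classical_set_scope.
Local Open Scope ring_scope.

(* The library norm on 'rV[R]_n is the sup norm, hence this definition; both
   norms induce the same topology, so `continuous` and `differentiable` have
   their usual meaning. *)
Definition enorm (R : realType) (n : nat) (x : 'rV[R]_n) : R :=
  Num.sqrt (\sum_(i < n) x ord0 i ^+ 2).

Definition elipschitz (R : realType) (m n : nat) (L : R)
    (g : 'rV[R]_m -> 'rV[R]_n) : Prop :=
  forall a b, enorm (g a - g b) <= L * enorm (a - b).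

Definition gradient (R : realType) (n : nat) (F : 'rV[R]_n -> R)
    (u : 'rV[R]_n) : 'rV[R]_n :=
  \row_(i < n) 'D_(delta_mx ord0 i) F u.

Definition steady_state_map (R : realType) (n p r : nat)
    (f : 'rV[R]_n -> 'rV[R]_p -> 'rV[R]_r -> 'rV[R]_n)
    (xss : 'rV[R]_p -> 'rV[R]_r -> 'rV[R]_n) : Prop :=
  forall u w, unique (fun x => f x u w = x) (xss u w).

Definition reduced_cost (R : realType) (n p q r : nat)
    (Psi : 'rV[R]_p -> 'rV[R]_q -> R)
    (h : 'rV[R]_n -> 'rV[R]_r -> 'rV[R]_q)
    (xss : 'rV[R]_p -> 'rV[R]_r -> 'rV[R]_n)
    (w : 'rV[R]_r) (u : 'rV[R]_p) : R :=
  Psi u (h (xss u w) w).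

(* Only the directions v t and ratios delta t with t even are used, and y 0
   plays no role. *)
Definition direct_search (R : realType) (n p q r : nat)
    (f : 'rV[R]_n -> 'rV[R]_p -> 'rV[R]_r -> 'rV[R]_n)
    (h : 'rV[R]_n -> 'rV[R]_r -> 'rV[R]_q)
    (Psi : 'rV[R]_p -> 'rV[R]_q -> R) (w : 'rV[R]_r) (delta : nat -> R)
    (u0 : 'rV[R]_p) (x0 : 'rV[R]_n) (v : nat -> 'rV[R]_p)
    (u : nat -> 'rV[R]_p) (x : nat -> 'rV[R]_n) (y : nat -> 'rV[R]_q) : Prop :=
  [/\ u 0 = u0 /\ x 0 = x0,
      forall t, x t.+1 = f (x t) (u t) w,
      forall t, y t.+1 = h (x t.+1) w,
      forall t, ~~ odd t -> u t.+1 = u t + delta t *: v t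
    & forall t, ~~ odd t ->
        u t.+2 = if Psi (u t.+1) (y t.+2) <= Psi (u t) (y t.+1)
                 then u t.+1 else u t].

Definition oracle_error (R : realType) (p q : nat)
    (Psi : 'rV[R]_p -> 'rV[R]_q -> R) (Phi : 'rV[R]_p -> R)
    (u : nat -> 'rV[R]_p) (y : nat -> 'rV[R]_q) (t : nat) : R :=
  `|Psi (u t) (y t.+1) - Phi (u t)|.

(* X ~ N(0, s^2 I): the law of X is the product of p copies of N(0, s^2), which
   the product rule on measurable boxes determines. The second argument of
   normal_prob is the standard deviation. *)
Definition isotropic_gaussian d (Omega : measurableType d) (R : realType)
    (P : probability Omega R) (p : nat) (s : R) (X : Omega -> 'rV[R]_p) : Prop :=
  (forall i, measurable_fun setT (fun o => X o ord0 i)) /\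
  forall A : 'I_p -> set R, (forall i, measurable (A i)) ->
    P [set o | forall i, A i (X o ord0 i)]
    = (\prod_(i < p) normal_prob 0%R s (A i))%E.

(* sigma(X s : s in S), the sigma-algebra generated by the coordinates of the
   X s. *)
Definition sigma_vectors d (Omega : measurableType d) (R : realType) (p : nat)
    (S : set nat) (X : nat -> Omega -> 'rV[R]_p) : set (set Omega) :=
  <<s \bigcup_(s in S) \bigcup_(i in [set: 'I_p])
        preimage_set_system setT (fun o => X s o ord0 i) measurable >>.

Definition random_directions d (Omega : measurableType d) (R : realType)
    (P : probability Omega R) (p : nat) (v : nat -> Omega -> 'rV[R]_p) : Prop :=
  forall t, ~~ odd t ->
    isotropic_gaussian P (Num.sqrt (p%:R^-1)) (v t) /\
    forall A B, sigma_vectors [set t] v A ->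
      sigma_vectors [set s | ~~ odd s /\ (s < t)%N] v B ->
      P (A `&` B) = (P A * P B)%E.

(* Main.v *)
Require Import Defs.
From HB Require Import structures.
From mathcomp Require Import all_boot all_order all_algebra.
From mathcomp Require Import all_classical all_reals all_analysis.
From mathcomp Require Import measurable_realfun charge ring lra.

Set Implicit Arguments.
Unset Strict Implicit.
Unset Printing Implicit Defensive.

Import Order.TTheory GRing.Theory Num.Theory.
Import numFieldNormedType.Exports.

Local Open Scope classical_set_scope.
Local Open Scope ring_scope.

(** A probe in a Gaussian direction tests the slope of the reduced cost [Phi].
Let [g] be the gradient of [Phi] at [u_t]. Since the gradient is
[L]-Lipschitz, moving by [delta v] changes [Phi] by at most
[delta <g, v> + L delta^2 |v|^2 / 2], and keeping the point with the smaller
measured cost keeps the better of the two points up to the two oracle errors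
([accepted_value_le]). So every period lowers [Phi] by [delta max(0, <-g, v>)],
up to [L delta^2 |v|^2 / 2] and the errors ([search_step_pointwise]). Written
with [Phi - Philow], this inequality has only nonnegative terms; it can
therefore be integrated without knowing beforehand that anything is integrable.

The iterate [u_t], hence [g], is a function of the earlier directions, and [v]
is independent of them. The expectation of [max(0, <-g, v>)] is then computed
with [g] frozen ([indep_tonelli]). A linear form [<a, v>] is a centred Gaussian
of standard deviation [|a| / sqrt p] ([ge0_integral_gaussian_lin]), so the
expectation is [E|g| / sqrt (2 pi p)] ([expected_probe_slope]). The law of
[<a, v>] comes from adding the coordinates one at a time; each addition is the
rotation invariance of the planar Gaussian measure ([normal_rotation]).

Summing over the periods ([telescope_le]) bounds
[sum_t delta_t E|grad Phi (u_t)| / sqrt (2 pi p)] by the initial gap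
[Phi u0 - Philow], plus [L / 2 sum_t 1 / (t + 1)], plus the two parts of the
error bound. The left side grows like [sqrt T] times the smallest
[E|grad Phi (u_t)|], while [sum_t 1 / (t + 1)] grows like [log T]. The lower
bounds on [T] make the right side smaller than the left side would be if every
[E|grad Phi (u_t)|] exceeded [eps] ([gap_budget_lt]).

The freezing argument needs [u_t] and [x_t] to be measurable with respect to
the past directions. The measured cost is Lipschitz in the state and
continuous in the input, so it is jointly continuous and the acceptance test is
a measurable event ([run_measurable]). *)

(** * Estimates for the probing ratios *)

(** The hypothesis controls [ln K], the conclusion [ln s]. If [s < K^2] then
[ln s <= 2 ln K]; otherwise [K <= sqrt s], and [ln s = 2 ln (sqrt s)] is at most
[2 sqrt s]. *)
Lemma mul_ln_le (R : realType) (K s : R) : 0 < K -> 1 <= s ->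
  K * `|ln K| <= s -> K * ln s <= 2 * s.
Proof.
move=> K0 s1 Ks; have s0 : 0 < s by lra.
have [sK|Ks2] := ltP s (K ^+ 2).
  have : ln s <= 2 * ln K.
    have -> : 2 * ln K = ln (K ^+ 2) by rewrite lnXn// mulr_natl.
    by rewrite ler_ln ?posrE ?exprn_gt0// ltW.
  have := ler_norm (ln K); nra.
have sq0 : 0 < Num.sqrt s by rewrite sqrtr_gt0.
have ss : Num.sqrt s ^+ 2 = s by rewrite sqr_sqrtr// ltW.
have Kq : K <= Num.sqrt s.
  by rewrite -(ler_pXn2r (n:=2))// ?nnegrE ?ss// ltW.
have -> : ln s = 2 * ln (Num.sqrt s) by rewrite -{1}ss lnXn// mulr_natl.
have := le_ln1Dx (x := Num.sqrt s - 1).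
rewrite addrCA subrr addr0 => h.
have {}h : ln (Num.sqrt s) <= Num.sqrt s - 1 by apply: h; lra.
have : 0 <= ln (Num.sqrt s).
  by rewrite ln_ge0// -sqrtr1 ler_sqrt//; lra.
nra.
Qed.

(** Each term beyond the first is at most half of
[ln (2k + 1) - ln (2k - 1)], because [ln (1 - x) <= - x]. *)
Lemma sum_inv_odd_le (R : realType) (N : nat) :
  \sum_(k < N.+1) (2 * k%:R + 1 : R)^-1 <= 1 + ln (2 * N%:R + 1) / 2.
Proof.
elim: N => [|N ih].
  by rewrite big_ord_recr big_ord0/= mulr0 !add0r invr1 ln1 mul0r addr0.
rewrite big_ord_recr/=.
have N0 : 0 <= N%:R :> R by rewrite ler0n.
have a0 : 0 < 2 * N%:R + 1 :> R by lra.
have b0 : 0 < 2 * N.+1%:R + 1 :> R by rewrite -natr1; lra.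
suff : 2 * (2 * N.+1%:R + 1 : R)^-1 <= ln (2 * N.+1%:R + 1) - ln (2 * N%:R + 1).
  by move: ih; lra.
have e : (2 * N%:R + 1) / (2 * N.+1%:R + 1) = 1 - 2 * (2 * N.+1%:R + 1 : R)^-1.
  rewrite -natr1 in b0 *; field; rewrite gt_eqF//; lra.
have := le_ln1Dx (x := - (2 * (2 * N.+1%:R + 1 : R)^-1)).
rewrite -e ln_div ?posrE// => h.
suff : - 1 < - (2 * (2 * N.+1%:R + 1 : R)^-1) by move=> /h; lra.
have : 0 < (2 * N%:R + 1) / (2 * N.+1%:R + 1) :> R by rewrite divr_gt0.
by rewrite e; lra.
Qed.

(** The increment of [sqrt (2N)] in [N] is
[2 / (sqrt (2N + 2) + sqrt (2N))], and the sum of the two roots is at least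
[sqrt 2 sqrt (2N + 1)]. *)
Lemma sum_inv_sqrt_odd_ge (R : realType) (N : nat) :
  Num.sqrt (2 * N%:R) <= Num.sqrt 2 * \sum_(k < N) (Num.sqrt (2 * k%:R + 1) : R)^-1.
Proof.
elim: N => [|N ih]; first by rewrite big_ord0 mulr0 mulr0 sqrtr0.
rewrite big_ord_recr/= mulrDr.
have N0 : 0 <= N%:R :> R by rewrite ler0n.
suff : Num.sqrt (2 * N.+1%:R) - Num.sqrt (2 * N%:R) <= Num.sqrt 2 / (Num.sqrt (2 * N%:R + 1) : R).
  by move: ih; lra.
have q0 : 0 < Num.sqrt (2 * N%:R + 1) :> R by rewrite sqrtr_gt0; lra.
rewrite ler_pdivlMr//.
have a0 := sqrtr_ge0 (2 * N%:R : R).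
have b0 := sqrtr_ge0 (2 * N.+1%:R : R).
have c0 := sqrtr_ge0 (2 : R).
have ea : Num.sqrt (2 * N%:R : R) ^+ 2 = 2 * N%:R by rewrite sqr_sqrtr//; lra.
have eb : Num.sqrt (2 * N.+1%:R : R) ^+ 2 = 2 * N%:R + 2.
  by rewrite sqr_sqrtr -natr1; lra.
have ec : Num.sqrt (2 : R) ^+ 2 = 2 by rewrite sqr_sqrtr//; lra.
have eq : Num.sqrt (2 * N%:R + 1 : R) ^+ 2 = 2 * N%:R + 1 by rewrite sqr_sqrtr//; lra.
move: a0 b0 c0 q0 ea eb ec eq.
move: (Num.sqrt (2 * N%:R)) (Num.sqrt (2 * N.+1%:R)) (Num.sqrt 2) (Num.sqrt (2 * N%:R + 1)) => a b c q a0 b0 c0 q0 ea eb ec eq.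
have ba0 : 0 < b + a by nra.
have hq : 2 * q <= c * (a + b).
  rewrite -(ler_pXn2r (n:=2))// ?nnegrE; [|nra|nra].
  have -> : (c * (a + b)) ^+ 2 = c ^+ 2 * (a ^+ 2 + 2 * (a * b) + b ^+ 2) by ring.
  by rewrite exprMn ec ea eb eq; have := mulr_ge0 a0 b0; lra.
rewrite -(ler_pM2l ba0).
have -> : (b + a) * ((b - a) * q) = (b ^+ 2 - a ^+ 2) * q by ring.
by rewrite ea eb; lra.
Qed.

Lemma sum_geom_sqrt_le (R : realType) (rho : R) (N : nat) : 0 < rho < 1 ->
  (1 - Num.sqrt rho) * \sum_(k < N) rho ^+ k <= 1.
Proof.
move=> /andP[r0 r1].
have e : (1 - rho) * \sum_(k < N) rho ^+ k = 1 - rho ^+ N.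
  by have := subrX1 rho N; lra.
have S0 : 0 <= \sum_(k < N) rho ^+ k.
  by apply: sumr_ge0 => k _; rewrite exprn_ge0// ltW.
have q0 : 0 <= Num.sqrt rho by exact: sqrtr_ge0.
have q1 : Num.sqrt rho < 1 by rewrite -sqrtr1 ltr_sqrt.
have qq : Num.sqrt rho ^+ 2 = rho by rewrite sqr_sqrtr// ltW.
have rN : 0 <= rho ^+ N by rewrite exprn_ge0// ltW.
by nra.
Qed.

(** After multiplication by [(sqrt 2 + 1) B] and with [s = sqrt T], the terms
with [D + L / 2], with the logarithm, with [c0] and with [cb] are at most
[eps s / 2], [eps s / 2], [eps s / 8] and [eps S / 16], where [S] is the sum of
the probing ratios. Since [s <= sqrt 2 S] and [sqrt 2 <= 3 / 2], they add up to
less than [12 / 5 eps S], and [12 / 5 <= sqrt 2 + 1]. *)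
Lemma gap_budget_lt (R : realType) (D L c0 cb rho eps B : R) (N : nat) :
  0 <= D -> 0 < L -> 0 <= c0 -> 0 <= cb -> 0 < rho < 1 -> 0 < eps -> 0 < B ->
  let A := Num.sqrt 2 + 1 in
  16 * cb * A * B <= eps ->
  (B * A * (4 * D + L) / eps) ^+ 2 <= (2 * N.+1%:R) ->
  let K := 2 * A * B * L / eps in
  (K * ln K) ^+ 2 <= 2 * N.+1%:R ->
  (8 * A * B * c0 / ((1 - Num.sqrt rho) * eps)) ^+ 2 <= 2 * N.+1%:R ->
  D + L / 2 * (\sum_(k < N.+1) (2 * k%:R + 1)^-1) + c0 * (\sum_(k < N.+1) rho ^+ k)
    + cb * (\sum_(k < N.+1) (Num.sqrt (2 * k%:R + 1))^-1)
  < eps / B * \sum_(k < N.+1) (Num.sqrt (2 * k%:R + 1))^-1.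
Proof.
move=> D0 L0 c00 cb0 rho01 e0 B0 A hcb hT K hK hc.
set S := \sum_(k < N.+1) (Num.sqrt (2 * k%:R + 1))^-1.
have /andP[r0 r1] := rho01.
have sq2 : Num.sqrt (2 : R) ^+ 2 = 2 by rewrite sqr_sqrtr//; lra.
have sq20 : 0 <= Num.sqrt (2 : R) by exact: sqrtr_ge0.
have sq21 : 7/5 <= Num.sqrt (2 : R) by nra.
have sq22 : Num.sqrt (2 : R) <= 3/2 by nra.
have A0 : 0 < A by rewrite /A; lra.
have N0 : 0 <= N%:R :> R by rewrite ler0n.
pose s : R := Num.sqrt (2 * N.+1%:R).
have T0 : 0 <= 2 * N.+1%:R :> R by rewrite -natr1; lra.
have ss : s ^+ 2 = 2 * N.+1%:R by rewrite sqr_sqrtr.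
have s0 : 0 <= s by exact: sqrtr_ge0.
have s1 : 1 <= s by move: ss; rewrite -natr1; nra.
have le_s x : x ^+ 2 <= 2 * N.+1%:R -> `|x| <= s.
  by rewrite -sqrtr_sqr => xx; rewrite ler_sqrt.
have K0 : 0 < K by rewrite /K !mulr_gt0// invr_gt0.
have h2 : K * ln s <= 2 * s.
  by apply: mul_ln_le => //; have /le_s := hK; rewrite normrM gtr0_norm.
have h1 : B * A * (4 * D + L) <= eps * s.
  by have /le_s/(le_trans (ler_norm _)) := hT; rewrite ler_pdivrMr// [s * _]mulrC.
have q1 : Num.sqrt rho < 1 by rewrite -sqrtr1 ltr_sqrt.
have h3 : 8 * A * B * c0 <= (1 - Num.sqrt rho) * eps * s.
  have /le_s/(le_trans (ler_norm _)) := hc.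
  by rewrite ler_pdivrMr ?[s * _]mulrC// mulr_gt0// subr_gt0.
have hS : s <= Num.sqrt 2 * S by exact: sum_inv_sqrt_odd_ge.
have hS0 : 0 < S by nra.
have hlog : \sum_(k < N.+1) (2 * k%:R + 1)^-1 <= 1 + ln s.
  apply: le_trans (sum_inv_odd_le _ _) _; rewrite lerD2l.
  rewrite ler_pdivrMr//; have -> : ln s * 2 = ln (s ^+ 2).
    by rewrite lnXn ?mulr_natr//; lra.
  by rewrite ss ler_ln ?posrE -?(natr1 N); lra.
have h2' : A * B * L * ln s <= s * eps.
  have -> : A * B * L * ln s = K * ln s / 2 * eps.
    by rewrite /K; field; rewrite gt_eqF.
  by rewrite ler_pM2r//; lra.
have G0 : 0 <= \sum_(k < N.+1) rho ^+ k.
  by apply: sumr_ge0 => k _; rewrite exprn_ge0// ltW.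
have hG := sum_geom_sqrt_le N.+1 rho01.
move: hlog G0 hG.
move: (\sum_(k < _) _^-1) (\sum_(k < N.+1) _ ^+ k) => H G hlog G0 hG.
rewrite [eps / B * S]mulrAC ltr_pdivlMr// -(ltr_pM2r A0).
have AB0 : 0 < A * B by rewrite mulr_gt0.
have g1 : A * B * (D + L / 2) <= eps * s / 2 by nra.
have g2 : A * B * (L / 2 * H) <= A * B * (L / 2) + eps * s / 2.
  have -> : A * B * (L / 2 * H) = A * B * L * H / 2 by ring.
  have := ler_wpM2l (ltW (mulr_gt0 AB0 L0)) hlog; lra.
have g3 : A * B * (c0 * G) <= eps * s / 8.
  have -> : A * B * (c0 * G) = 8 * A * B * c0 * G / 8 by field.
  have h3' := ler_wpM2r G0 h3.
  have := ler_wpM2l (mulr_ge0 (ltW e0) s0) hG; lra.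
have g4 : A * B * (cb * S) <= eps * S / 16.
  have := ler_wpM2r (ltW hS0) hcb; lra.
have g5 : eps * s <= eps * (Num.sqrt 2 * S) by rewrite ler_pM2l.
have eS : 0 < eps * S by rewrite mulr_gt0.
have g6 : eps * (Num.sqrt 2 * S) <= 3 / 2 * (eps * S).
  by rewrite mulrCA ler_pM2r.
have g7 : 12 / 5 * (eps * S) <= eps * S * A by rewrite mulrC ler_pM2l// /A; lra.
have -> : (D + L / 2 * H + c0 * G + cb * S) * B * A =
  A * B * D + A * B * (L / 2 * H) + A * B * (c0 * G) + A * B * (cb * S) by ring.
lra.
Qed.

(** * Integration against normal laws *)

(** The normal law is defined by its density, so the density is its
Radon-Nikodym derivative almost everywhere. *)
Lemma ge0_integral_normal_prob (R : realType) (m s : R) (f : R -> \bar R) :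
  measurable_fun setT f -> (forall x, 0 <= f x)%E ->
  (\int[normal_prob m s]_x f x
   = \int[lebesgue_measure]_x (f x * (normal_pdf m s x)%:E))%E.
Proof.
move=> mf f0.
have dom := normal_prob_dominates m s.
rewrite -(Radon_Nikodym_SigmaFinite.change_of_variables dom)//.
set g := Radon_Nikodym_SigmaFinite.f _ _.
have mg : measurable_fun setT g.
  exact: measurable_int (Radon_Nikodym_SigmaFinite.f_integrable dom).
have mpdf : measurable_fun setT (fun x => (normal_pdf m s x)%:E).
  by apply/measurable_EFinP; exact: measurable_normal_pdf.
apply: ge0_ae_eq_integral => //.
- exact: emeasurable_funM.
- exact: emeasurable_funM.
- by move=> x _; rewrite mule_ge0// Radon_Nikodym_SigmaFinite.f_ge0.
- by move=> x _; rewrite mule_ge0// lee_fin normal_pdf_ge0.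
have : ae_eq lebesgue_measure setT g (fun x => (normal_pdf m s x)%:E).
  apply: integral_ae_eq => //.
    exact: Radon_Nikodym_SigmaFinite.f_integrable.
  by move=> E _ mE; rewrite -Radon_Nikodym_SigmaFinite.f_integral.
by apply: filterS => x /(_ I) + _ => ->.
Qed.

Lemma lebesgue_measure_affine (R : realType) (a b : R) (A : set R) : a != 0 ->
  measurable A ->
  (`|a|%:E * lebesgue_measure [set x : R | A (b + a * x)%R] = lebesgue_measure A)%E.
Proof.
move=> a0 mA.
pose phi : measurableTypeR R -> measurableTypeR R := fun x => b + a * x.
have mphi : measurable_fun setT phi.
  by apply: measurable_funD => //; apply: measurable_funM.
apply/esym.
pose nu := measure_function_pushforward__canonical__measure_function_Measure lebesgue_measure mphi.
pose mu := mscale (NngNum (normr_ge0 a)) nu.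
rewrite -[RHS]/(mu A); apply: lebesgue_measure_unique => //= _ [[c e]] _ <-.
rewrite /mu/= /mscale/= /pushforward/=.
rewrite lebesgue_measure_itv/=.
have [ap|an|a00] := ltrgtP a 0; last by rewrite a00 eqxx in a0.
- have -> : phi @^-1` `]c, e]%classic = `[(e - b) / a, (c - b) / a[%classic.
    apply/seteqP; split => x/=; rewrite /phi !in_itv/=.
      by rewrite ler_ndivrMr// ltr_ndivlMr// => /andP[? ?]; apply/andP; split; lra.
    by rewrite ler_ndivrMr// ltr_ndivlMr// => /andP[? ?]; apply/andP; split; lra.
  rewrite lebesgue_measure_itv/= !lte_fin ltr_nM2r ?invr_lt0// ltrD2r.
  case: ifPn => _; last by rewrite mule0.
  by rewrite -!EFinD -EFinM; congr EFin; rewrite ltr0_norm//; field; lra.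
- have -> : phi @^-1` `]c, e]%classic = `](c - b) / a, (e - b) / a]%classic.
    apply/seteqP; split => x/=; rewrite /phi !in_itv/=.
      by rewrite ltr_pdivrMr// ler_pdivlMr// => /andP[? ?]; apply/andP; split; lra.
    by rewrite ltr_pdivrMr// ler_pdivlMr// => /andP[? ?]; apply/andP; split; lra.
  rewrite lebesgue_measure_itv/= !lte_fin ltr_pM2r ?invr_gt0// ltrD2r.
  case: ifPn => _; last by rewrite mule0.
  by rewrite -!EFinD -EFinM; congr EFin; rewrite gtr0_norm//; field; lra.
Qed.

Lemma ge0_integral_affine (R : realType) (a b : R) (f : R -> \bar R) : a != 0 ->
  measurable_fun setT f -> (forall x, 0 <= f x)%E ->
  (\int[lebesgue_measure]_x f x
   = \int[lebesgue_measure]_x (f (b + a * x)%R * `|a|%:E))%E.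
Proof.
move=> a0 mf f0.
pose phi : measurableTypeR R -> measurableTypeR R := fun x => b + a * x.
have mphi : measurable_fun setT phi.
  by apply: measurable_funD => //; apply: measurable_funM.
have mfphi : measurable_fun setT (f \o phi) by exact: measurableT_comp.
under [RHS]eq_integral do rewrite muleC.
rewrite ge0_integralZl//.
have -> : (\int[lebesgue_measure]_x f (b + a * x)%R =
    \int[pushforward lebesgue_measure phi]_x f x)%E.
  by rewrite ge0_integral_pushforward//= => x _; exact: f0.
rewrite -(ge0_integral_mscale _ _ (NngNum (normr_ge0 a)))//=.
apply: eq_measure_integral => A mA _.
exact/esym/lebesgue_measure_affine.
Qed.

Lemma normal_peakZ (R : realType) (t s : R) : 0 <= t ->
  normal_peak (t * s) = t^-1 * normal_peak s.
Proof.
move=> t0; rewrite /normal_peak -invfM; congr _^-1.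
have -> : (t * s) ^+ 2 * pi *+ 2 = t ^+ 2 * (s ^+ 2 * pi *+ 2) by ring.
by rewrite sqrtrM ?sqr_ge0// sqrtr_sqr ger0_norm.
Qed.

(** Completing the square in [x]: the joint density of two standard normal
variables, in the coordinates [x] and [z = (a x + b y) / c], factors as the law
of [z] times the conditional law of [x] given [z]. *)
Lemma normal_pdf_rotation (R : realType) (a b c x z : R) : b != 0 -> 0 < c ->
  c ^+ 2 = a ^+ 2 + b ^+ 2 ->
  normal_pdf 0 1 x * (normal_pdf 0 1 ((c * z - a * x) / b) * (c / `|b|))
  = normal_pdf 0 1 z * normal_pdf (a * z / c) (`|b| / c) x.
Proof.
move=> b0 c0 e.
have nb : 0 < `|b| by rewrite normr_gt0.
have bc0 : `|b| / c != 0 by rewrite gt_eqF// divr_gt0.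
rewrite !normal_pdfE ?oner_eq0//.
have -> : normal_peak (`|b| / c) = c / `|b| * normal_peak 1.
  by rewrite -{1}[_ / c]mulr1 normal_peakZ ?invf_div// divr_ge0 ?normr_ge0// ltW.
have E : normal_fun 0 1 x * normal_fun 0 1 ((c * z - a * x) / b) =
    normal_fun 0 1 z * normal_fun (a * z / c) (`|b| / c) x.
  rewrite /normal_fun -!expRD; congr expR.
  have -> : (`|b| / c) ^+ 2 = b ^+ 2 / c ^+ 2.
    by rewrite expr_div_n real_normK ?num_real.
  have num : b ^+ 2 * x ^+ 2 + (c * z - a * x) ^+ 2
           = b ^+ 2 * z ^+ 2 + (c * x - a * z) ^+ 2.
    apply/eqP; rewrite -subr_eq0; apply/eqP.
    transitivity ((a ^+ 2 + b ^+ 2 - c ^+ 2) * (x ^+ 2 - z ^+ 2)); first by ring.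
    by rewrite -e subrr mul0r.
  transitivity (- (b ^+ 2 * x ^+ 2 + (c * z - a * x) ^+ 2) / (b ^+ 2 *+ 2)).
    by field.
  rewrite num; field; by rewrite b0 gt_eqF.
transitivity (normal_peak 1 * normal_peak 1 * (c / `|b|) *
  (normal_fun 0 1 x * normal_fun 0 1 ((c * z - a * x) / b))); first by ring.
by rewrite E; ring.
Qed.

(** Substituting [z] for [y] and exchanging the integrals leaves an integral in
[x] that [normal_pdf_rotation] evaluates. In other words [a X + b Y] and
[sqrt (a^2 + b^2) X] have the same law for independent standard normal [X]
and [Y]. *)
Lemma normal_rotation (R : realType) (a b : R) (f : R -> \bar R) : 0 <= a ->
  measurable_fun setT f -> (forall x, 0 <= f x)%E ->
  let phi x := (normal_pdf 0 1 x : R)%:E in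
  (\int[lebesgue_measure]_x (\int[lebesgue_measure]_y (f (a * x + b * y)%R * phi y) * phi x)
   = \int[lebesgue_measure]_z (f (Num.sqrt (a ^+ 2 + b ^+ 2) * z)%R * phi z))%E.
Proof.
move=> a0 mf f0 phi.
have phi0 x : (0 <= phi x)%E by rewrite lee_fin normal_pdf_ge0.
have mphi : measurable_fun setT phi.
  by apply/measurable_EFinP; exact: measurable_normal_pdf.
have maff u v : measurable_fun setT (fun x : R => f (u + v * x)%R).
  by apply: (measurableT_comp mf); apply: measurable_funD.
have [->|b0] := eqVneq b 0.
  rewrite expr0n addr0 sqrtr_sqr ger0_norm//; apply: eq_integral => x _.
  under eq_integral do rewrite mul0r addr0.
  rewrite ge0_integralZl// integral_normal_pdf mule1//.
set c := Num.sqrt _.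
have c2 : c ^+ 2 = a ^+ 2 + b ^+ 2 by rewrite sqr_sqrtr// addr_ge0 ?sqr_ge0.
have c0 : 0 < c by rewrite sqrtr_gt0 ltr_wpDl ?sqr_ge0// exprn_even_gt0.
pose F (p : R * R) := (f (c * p.2)%R *
  (normal_pdf 0 1 p.1 * (normal_pdf 0 1 ((c * p.2 - a * p.1) / b) * (c / `|b|)))%:E)%E.
have F0 p : (0 <= F p)%E.
  by rewrite mule_ge0// lee_fin !mulr_ge0 ?normal_pdf_ge0 ?invr_ge0 ?normr_ge0// ltW.
have mF : measurable_fun setT F.
  apply: emeasurable_funM.
    apply: (measurableT_comp mf); exact: measurable_funM.
  apply/measurable_EFinP; apply: measurable_funM.
    exact: (measurableT_comp (measurable_normal_pdf _ _)).
  apply: measurable_funM => //.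
  apply: (measurableT_comp (measurable_normal_pdf _ _)).
  apply: measurable_funM => //; apply: measurable_funB => //; exact: measurable_funM.
transitivity (\int[lebesgue_measure]_x \int[lebesgue_measure]_z F (x, z))%E.
  apply: eq_integral => x _.
  rewrite (@ge0_integral_affine _ (c / b) (- (a * x / b))); last 3 first.
  - by rewrite mulf_neq0// ?invr_eq0// gt_eqF.
  - by apply: emeasurable_funM => //; exact: maff.
  - by move=> y; rewrite mule_ge0.
  rewrite -ge0_integralZr//; last 2 first.
  - apply: emeasurable_funM => //; apply: emeasurable_funM.
      apply: (measurableT_comp mf); apply: measurable_funD => //.
      by apply: measurable_funM => //; apply: measurable_funD => //; exact: measurable_funM.
    apply: (measurableT_comp mphi); apply: measurable_funD => //; exact: measurable_funM.
  - by move=> y _; rewrite !mule_ge0.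
  apply: eq_integral => z _; rewrite /F/=.
  have -> : a * x + b * (- (a * x / b) + c / b * z) = c * z by field.
  have -> : - (a * x / b) + c / b * z = (c * z - a * x) / b by field.
  rewrite normrM normfV (gtr0_norm c0) /phi -!muleA -!EFinM; congr (_ * _%:E)%E.
  by ring.
rewrite fubini_tonelli//; apply: eq_integral => z _.
under eq_integral do rewrite /F/= (normal_pdf_rotation _ _ b0 c0 c2) EFinM muleA.
rewrite ge0_integralZl ?integral_normal_pdf ?mule1//.
- by apply/measurable_EFinP; exact: measurable_normal_pdf.
- by move=> x _; rewrite lee_fin normal_pdf_ge0.
- by rewrite mule_ge0// lee_fin normal_pdf_ge0.
Qed.

(** Let [M] be the second moment. For [0 < r < 1], the inequality
[1 + h x^2 / 2 <= exp (h x^2 / 2)] with [h = 1 - r^2] integrates to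
[1 + h M / 2 <= 1 / r], as the product of the exponential and the standard
density is [1 / r] times the density of standard deviation [1 / r]. Hence
[M <= 2 / (r (1 + r))] for every such [r], and [r] tends to [1]. *)
Lemma normal_moment2_le1 (R : realType) :
  (\int[lebesgue_measure]_x ((x ^+ 2)%:E * (normal_pdf 0 1 x : R)%:E) <= 1)%E.
Proof.
set M := (\int[_]_x _)%E.
have M0 : (0 <= M)%E.
  by apply: integral_ge0 => x _; rewrite mule_ge0// lee_fin ?sqr_ge0// normal_pdf_ge0.
have mpdf s : measurable_fun [set: R] (fun x => (normal_pdf 0 s x)%:E).
  by apply/measurable_EFinP; exact: measurable_normal_pdf.
have msq : measurable_fun [set: R] (fun x => (x ^+ 2)%:E).
  by apply/measurable_EFinP; exact: measurable_funX.
have msp : measurable_fun [set: R] (fun x => ((x ^+ 2)%:E * (normal_pdf 0 1 x)%:E)%E).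
  exact: emeasurable_funM.
have p0 s x : (0 <= (normal_pdf 0 s x : R)%:E)%E by rewrite lee_fin normal_pdf_ge0.
have s0 x : (0 <= (x ^+ 2 : R)%:E)%E by rewrite lee_fin sqr_ge0.
have key r : 0 < r < 1 -> (M * ((1 - r ^+ 2) / 2)%:E + 1 <= r^-1%:E)%E.
  move=> /andP[r0 r1].
  have r21 : (0 <= ((1 - r ^+ 2) / 2)%:E)%E by rewrite lee_fin; nra.
  have ri0 : (0 <= r^-1%:E)%E by rewrite lee_fin invr_ge0 ltW.
  have ms3 : measurable_fun [set: R]
      (fun x => ((x ^+ 2)%:E * (normal_pdf 0 1 x)%:E * ((1 - r ^+ 2) / 2)%:E)%E).
    exact: emeasurable_funM.
  rewrite -(integral_normal_pdf (0 : R) 1) -ge0_integralZr//; last first.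
    by move=> x _; rewrite mule_ge0.
  rewrite -ge0_integralD; last 5 first.
  - exact: measurableT.
  - by move=> x _; rewrite !mule_ge0.
  - exact: ms3.
  - by move=> x _; exact: p0.
  - exact: mpdf.
  have -> : r^-1%:E = (\int[lebesgue_measure]_x (r^-1%:E * (normal_pdf 0 r^-1 x)%:E))%E.
    rewrite ge0_integralZl//; first by rewrite integral_normal_pdf mule1.
    exact: mpdf.
  apply: ge0_le_integral => //.
  - move=> x _; apply: adde_ge0; last exact: p0.
    by apply: mule_ge0 => //; apply: mule_ge0; [exact: s0|exact: p0].
  - exact: emeasurable_funD ms3 (mpdf 1).
  - by apply: emeasurable_funM => //; exact: mpdf.
  move=> x _; rewrite -!EFinM -EFinD lee_fin.
  have -> : r^-1 * normal_pdf 0 r^-1 x = normal_pdf 0 1 x * expR (x ^+ 2 * ((1 - r ^+ 2) / 2)).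
    rewrite !normal_pdfE ?invr_eq0 ?gt_eqF//.
    rewrite -[X in normal_peak X]mulr1 normal_peakZ ?invrK ?invr_ge0 1?ltW//.
    rewrite mulrA mulKr ?unitfE ?gt_eqF// -mulrA /normal_fun -expRD; congr (_ * expR _).
    field; by rewrite gt_eqF.
  have := expR_ge1Dx (x ^+ 2 * ((1 - r ^+ 2) / 2)).
  have := normal_pdf_ge0 0 1 x; nra.
have Mfin : M \is a fin_num.
  rewrite ge0_fin_numE//; rewrite ltNge; apply/negP; rewrite leye_eq => /eqP Moo.
  have := key (1/2); rewrite Moo gt0_mulye ?addye// ?lte_fin; last lra.
  by rewrite leye_eq/= => h; have : false by apply: h; lra.
have [m Mm] : exists m : R, M = m%:E by exists (fine M); rewrite fineK.
rewrite Mm in key *; rewrite lee_fin leNgt; apply/negP => m1.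
have {}key (r : R) : 0 < r < 1 -> m * ((1 - r ^+ 2) / 2) + 1 <= r^-1.
  by move=> /key; rewrite -EFinM -EFinD lee_fin.
clear - m1 key.
(* At r = 1 - t the product r (1 + r) exceeds 2 - 3 t, and this t makes
   (2 - 3 t) m equal to m + 1 > 2. *)
pose t := (m - 1) / (3 * m).
have tm : t * (3 * m) = m - 1 by rewrite divfK//; lra.
have t0 : 0 < t by nra.
have t1 : t < 1/3 by nra.
have h : m * ((1 - (1 - t) ^+ 2) / 2) + 1 <= (1 - t)^-1 by apply: key; lra.
have r0 : 0 < 1 - t by lra.
have := ler_wpM2r (ltW r0) h; rewrite mulVf ?gt_eqF//.
nra.
Qed.

(** An antiderivative of [x exp (- x^2 / 2)] is [- exp (- x^2 / 2)]. *)
Lemma normal_pos_part (R : realType) :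
  (\int[lebesgue_measure]_x ((Num.max 0 x)%:E * (normal_pdf 0 1 x : R)%:E)
   = (Num.sqrt (2 * pi))^-1%:E)%E.
Proof.
pose F (x : R) := - normal_pdf 0 1 x.
pose f (x : R) := x * normal_pdf 0 1 x.
transitivity (\int[lebesgue_measure]_(x in `[0%R, +oo[) (f x)%:E)%E.
  rewrite [RHS]integral_mkcond; apply: eq_integral => x _.
  rewrite patchE/= mem_setE in_itv/= andbT -EFinM; case: (leP 0 x) => x0//.
  by rewrite mul0r.
pose g (x : R) := - x ^+ 2 / 2.
have pE : normal_pdf 0 (1 : R) = normal_peak 1 \*: (expR \o g).
  rewrite normal_pdfE ?oner_eq0//; apply/funext => x.
  by rewrite /normal_fun/= /g subr0 expr1n.
have dp (x : R) : is_derive x 1 (normal_pdf 0 (1 : R)) (- f x).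
  have dg : is_derive x 1 (g : R -> R) (- x).
    rewrite /g; apply: is_derive_eq; rewrite /GRing.scale/=; by field.
  have := is_deriveZ (normal_peak 1) (is_derive1_comp (is_derive_expR (g x)) dg).
  rewrite /f pE; congr is_derive; rewrite /= /GRing.scale/=; ring.
have dF (x : R) : is_derive x 1 F (f x).
  by rewrite -[f x]opprK; apply: is_deriveN.
have F0 : F 0 = - (Num.sqrt (2 * pi))^-1.
  rewrite /F pE /= /g expr0n/= oppr0 mul0r expR0 /normal_peak expr1n mul1r mulr_natl.
  by rewrite /GRing.scale/= mulr1.
have Fy : F x @[x --> +oo%R] --> 0.
  have h : gauss_fun (x * (Num.sqrt 2)^-1) @[x --> +oo%R] --> (0 : R).
    apply: (cvg_comp _ _ _ cvg_gauss_fun).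
    by apply: gt0_cvgMly; [exact: proper_pinfty_nbhs|rewrite invr_gt0 sqrtr_gt0|exact: cvg_id].
  have -> : F = fun x => - (normal_peak 1 * gauss_fun (x * (Num.sqrt 2)^-1)).
    apply/funext => x; rewrite /F pE/= /gauss_fun /g exprMn exprVn sqr_sqrtr//.
    by rewrite mulNr.
  by rewrite -oppr0 -(mulr0 (normal_peak 1)); apply: cvgN; apply: cvgMr.
rewrite (ge0_continuous_FTC2y (F := F) (l := 0)).
- by rewrite F0 -EFinB sub0r opprK.
- by move=> x x0; rewrite /f mulr_ge0// normal_pdf_ge0.
- apply: continuous_subspaceT => x; apply: cvgM; first exact: cvg_id.
  exact: (@continuous_normal_pdf R 0 1 (oner_neq0 _)).
- exact: Fy.
- by move=> x _; have [] := dF x.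
- apply: cvg_at_right_filter; apply: cvgN.
  exact: (@continuous_normal_pdf R 0 1 (oner_neq0 _)).
- by move=> x _; rewrite derive1E; have [] := dF x.
Qed.

(** * Independence and Gaussian vectors *)

(** Independence says that the joint law of [X] and [Y] is the product of
their laws, so Tonelli applies to it. The statement keeps both integrals on the
sample space, which lets [X] and [Y] be the identity into two sub-sigma-algebras. *)
Lemma indep_tonelli d d1 d2 (Omega : measurableType d) (T1 : measurableType d1)
    (T2 : measurableType d2) (R : realType) (P : probability Omega R)
    (X : Omega -> T1) (Y : Omega -> T2) (f : T1 * T2 -> \bar R) :
  measurable_fun setT X -> measurable_fun setT Y ->
  (forall A B, measurable A -> measurable B ->
    P (X @^-1` A `&` Y @^-1` B) = (P (X @^-1` A) * P (Y @^-1` B))%E) ->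
  measurable_fun setT f -> (forall z, 0 <= f z)%E ->
  (\int[P]_o f (X o, Y o) = \int[P]_o \int[P]_o' f (X o, Y o'))%E.
Proof.
move=> mX mY ind mf f0.
pose X' : {mfun Omega >-> T1} := HB.pack X (isMeasurableFun.Build _ _ _ _ X mX).
pose Y' : {mfun Omega >-> T2} := HB.pack Y (isMeasurableFun.Build _ _ _ _ Y mY).
have mXY : measurable_fun setT (fun o => (X o, Y o)) by exact: measurable_fun_pair.
pose XY' : {mfun Omega >-> (T1 * T2)%type} :=
  HB.pack (fun o => (X o, Y o)) (isMeasurableFun.Build _ _ _ _ _ mXY).
have mFy x : measurable_fun setT (fun y => f (x, y)) by exact: measurable_fun_pair2.
transitivity (\int[distribution P XY']_z f z)%E.
  by rewrite ge0_integral_distribution.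
transitivity (\int[(distribution P X' \x distribution P Y')%E]_z f z)%E.
  apply: eq_measure_integral => A mA _; apply/esym/product_measure_unique => //.
rewrite fubini_tonelli1// ge0_integral_distribution//=; last 2 first.
- exact: measurable_fun_fubini_tonelli_F.
- by move=> x; apply: integral_ge0.
by apply: eq_integral => o _; rewrite /fubini_F ge0_integral_distribution.
Qed.

(** Both sides are finite measures in [A] that agree on a pi-system. *)
Lemma indep_g_sigma d (Omega : measurableType d) (R : realType)
    (P : probability Omega R) (G : set (set Omega)) (B : set Omega) :
  G `<=` measurable -> setI_closed G -> G setT -> measurable B ->
  (forall A, G A -> P (A `&` B) = (P A * P B)%E) ->
  forall A, <<s G >> A -> P (A `&` B) = (P A * P B)%E.
Proof.
move=> Gm GI GT mB ind A sA.
have PB0 : (0 <= fine (P B))%R by rewrite fine_ge0.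
have PBE : (fine (P B))%:E = P B by rewrite fineK// fin_num_measure.
rewrite muleC -PBE.
apply: (g_sigma_algebra_measure_unique G Gm (fun=> setT) _ _
  (mrestr P mB) (mscale (NngNum PB0) P)) => //.
- by rewrite bigcup_const//; exists 0.
- by move=> E GE; rewrite /mrestr/= /mscale/= PBE muleC; exact: ind.
- by move=> _; change (P (setT `&` B) < +oo)%E; rewrite setTI -ge0_fin_numE// fin_num_measure.
Qed.

Lemma ge0_integral_normal_probZ (R : realType) (s : R) (f : R -> \bar R) : 0 < s ->
  measurable_fun setT f -> (forall x, 0 <= f x)%E ->
  (\int[normal_prob 0 s]_x f x
   = \int[lebesgue_measure]_z (f (s * z)%R * (normal_pdf 0 1 z)%:E))%E.
Proof.
move=> s0 mf f0; rewrite (ge0_integral_normal_prob _ _ mf f0).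
rewrite (@ge0_integral_affine _ s 0) ?gt_eqF//; last 2 first.
- apply: emeasurable_funM => //; apply/measurable_EFinP; exact: measurable_normal_pdf.
- by move=> x; rewrite mule_ge0// lee_fin normal_pdf_ge0.
apply: eq_integral => z _; rewrite add0r -muleA -EFinM; congr (_ * _%:E)%E.
rewrite !normal_pdfE ?oner_eq0 ?gt_eqF// gtr0_norm//.
have pk : normal_peak s * s = normal_peak 1.
  by rewrite -{1}(mulr1 s) normal_peakZ ?ltW// mulrC mulVKf ?gt_eqF.
rewrite mulrAC pk; congr (_ * expR _).
by field; rewrite gt_eqF.
Qed.

Section gaussian_vector.
Context d (Omega : measurableType d) (R : realType) (P : probability Omega R).
Variables (p : nat) (s : R) (X : Omega -> 'rV[R]_p).
Hypotheses (s0 : 0 < s) (hX : isotropic_gaussian P s X).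

Let mX i : measurable_fun setT (fun o => X o ord0 i).
Proof. by have [mX _] := hX; exact: mX. Qed.

Let box (A : 'I_p -> set R) := [set o | forall i, A i (X o ord0 i)].

Let boxP A : (forall i, measurable (A i)) ->
  P (box A) = (\prod_(i < p) normal_prob 0%R s (A i))%E.
Proof. by have [_ h] := hX; exact: h. Qed.

Let box1 j (B : set R) : (fun o => X o ord0 j) @^-1` B =
  box (fun i => if i == j then B else setT).
Proof.
apply/seteqP; split => o /=; last by move=> /(_ j); rewrite eqxx.
by move=> Bo i; case: eqP => [->|].
Qed.

Lemma gaussian_coord_prob j B : measurable B ->
  P ((fun o => X o ord0 j) @^-1` B) = normal_prob 0 s B.
Proof.
move=> mB; rewrite box1 boxP; last by move=> i; case: ifP.
rewrite (bigD1 j)//= eqxx big1 ?mule1// => i /negbTE ->.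
exact: probability_setT.
Qed.

Lemma ge0_integral_gaussian_coord j (f : R -> \bar R) :
  measurable_fun setT f -> (forall x, 0 <= f x)%E ->
  (\int[P]_o f (X o ord0 j)
   = \int[lebesgue_measure]_z (f (s * z)%R * (normal_pdf 0 1 z)%:E))%E.
Proof.
move=> mf f0; rewrite -ge0_integral_normal_probZ//.
have mX' : measurable_fun setT ((fun o => X o ord0 j) : Omega -> measurableTypeR R).
  exact: mX.
pose X' : {mfun Omega >-> measurableTypeR R} :=
  HB.pack (fun o => X o ord0 j) (isMeasurableFun.Build _ _ _ _ _ mX').
transitivity (\int[distribution P X']_x f x)%E.
  by rewrite ge0_integral_distribution.
apply: eq_measure_integral => A mA _; exact: gaussian_coord_prob.
Qed.

Let S (a : 'I_p -> R) k o := \sum_(i < p | (i < k)%N) a i * X o ord0 i.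

(** The partial sum only involves the coordinates below [j]; the boxes that
constrain those coordinates form a pi-system. *)
Let indS a (j : 'I_p) (A B : set R) : measurable A -> measurable B ->
  P (S a j @^-1` A `&` (fun o => X o ord0 j) @^-1` B)
  = (P (S a j @^-1` A) * P ((fun o => X o ord0 j) @^-1` B))%E.
Proof.
move=> mA mB.
pose G : set (set Omega) := [set E | exists C, [/\ forall i, measurable (C i),
  forall i : 'I_p, (j <= i)%N -> C i = setT & E = box C]].
have XG (i : 'I_p) : (i < j)%N ->
    measurable_fun (setT : set (g_sigma_algebraType G)) (fun o => X o ord0 i).
  move=> ij _ C mC; rewrite setTI; apply: sub_sigma_algebra.
  exists (fun l => if l == i then C else setT); split; last by rewrite box1.
    by move=> l; case: ifP.
  by move=> l jl; case: eqP => // li; rewrite li leqNgt ij in jl.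
have SG : measurable_fun (setT : set (g_sigma_algebraType G)) (S a j).
  rewrite /S; under eq_fun do rewrite big_mkcond.
  apply: measurable_sum => i; have [ij|ij] := boolP (i < j)%N; last exact: measurable_cst.
  by apply: measurable_funM => //; exact: XG.
have mbox C : (forall i, measurable (C i)) -> measurable (box C).
  move=> mC; have -> : box C = \bigcap_(i in [set: 'I_p]) ((fun o => X o ord0 i) @^-1` C i).
    by apply/seteqP; split => o h i; [move=> _|]; exact: h.
  apply: fin_bigcap_measurable; first exact: finite_finset.
  by move=> i _; rewrite -[X in measurable X]setTI; exact: mX.
apply: (@indep_g_sigma _ _ _ _ G).
- by move=> _ [C [mC _ ->]]; exact: mbox.
- move=> _ _ [C [mC C1 ->]] [D [mD D1 ->]]; exists (fun i => C i `&` D i); split.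
  + by move=> i; exact: measurableI.
  + by move=> i ji; rewrite C1// D1// setTI.
  + by apply/seteqP; split => o /= => [[h1 h2] i|h]; [split|split => i; have [] := h i].
- exists (fun=> setT); split => //.
  by apply/seteqP; split.
- by rewrite -[X in measurable X]setTI; exact: mX.
- move=> _ [C [mC C1 ->]].
  have -> : box C `&` (fun o => X o ord0 j) @^-1` B =
      box (fun i => if i == j then B else C i).
    apply/seteqP; split => o /=.
      by move=> [h Bo] i; case: eqP => [->|_].
    move=> h; split; last by have := h j; rewrite eqxx.
    move=> i; have := h i; case: eqP => // -> _; by rewrite C1.
  rewrite gaussian_coord_prob// !boxP//; last by move=> i; case: ifP.
  rewrite (bigD1 j)//= eqxx [in RHS](bigD1 j)//= C1//= probability_setT mul1e muleC.
  by congr (_ * _)%E; apply: eq_bigr => i /negbTE ->.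
- by rewrite -[X in <<s _ >> X]setTI; exact: SG.
Qed.

(** Freezing the partial sum and integrating the next coordinate leaves a
function of the partial sum, to which the induction hypothesis applies;
[normal_rotation] merges the two Gaussian integrals. *)
Let lawS a k (f : R -> \bar R) : (k <= p)%N ->
  measurable_fun setT f -> (forall x, 0 <= f x)%E ->
  (\int[P]_o f (S a k o)
   = \int[lebesgue_measure]_z
       (f (s * Num.sqrt (\sum_(i < p | (i < k)%N) a i ^+ 2) * z)%R
        * (normal_pdf 0 1 z)%:E))%E.
Proof.
elim: k f => [|k ih] f kp mf f0.
  transitivity (f 0).
    rewrite (eq_integral (cst (f 0))); last by move=> o _; rewrite /S big_pred0.
    by rewrite integral_cst//= probability_setT mule1.
  rewrite big_pred0// sqrtr0 mulr0; under eq_integral do rewrite mul0r.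
  rewrite ge0_integralZl//.
  - by rewrite integral_normal_pdf mule1.
  - by apply/measurable_EFinP; exact: measurable_normal_pdf.
  - by move=> x _; rewrite lee_fin normal_pdf_ge0.
pose j := Ordinal kp.
have decomp (F : 'I_p -> R) :
    \sum_(i < p | (i < k.+1)%N) F i = \sum_(i < p | (i < k)%N) F i + F j.
  rewrite (bigD1 j)/= ?ltnS// addrC; congr (_ + _); apply: eq_bigl => i.
  by rewrite ltnS [RHS]ltn_neqAle andbC.
have mSk : measurable_fun setT (S a k).
  rewrite /S; under eq_fun do rewrite big_mkcond.
  apply: measurable_sum => i; have [_|_] := boolP (i < k)%N; last exact: measurable_cst.
  by apply: measurable_funM => //; exact: mX.
pose phi (z : R) := (normal_pdf 0 1 z)%:E.
have mphi : measurable_fun setT phi.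
  by apply/measurable_EFinP; exact: measurable_normal_pdf.
have phi0 z : (0 <= phi z)%E by rewrite lee_fin normal_pdf_ge0.
have maff u v : measurable_fun setT (fun x : R => f (u + v * x)%R).
  by apply: (measurableT_comp mf); apply: measurable_funD.
pose F (z : R * R) := (f (z.1 + a j * s * z.2)%R * phi z.2)%E.
have mF : measurable_fun setT F.
  apply: emeasurable_funM; last exact: (measurableT_comp mphi).
  apply: (measurableT_comp mf); apply: measurable_funD => //.
  exact: measurable_funM.
have F0 z : (0 <= F z)%E by rewrite mule_ge0.
pose g (x : R) := (\int[lebesgue_measure]_z F (x, z))%E.
have mg : measurable_fun setT g by exact: measurable_fun_fubini_tonelli_F.
have g0 x : (0 <= g x)%E by apply: integral_ge0.
transitivity (\int[P]_o g (S a k o))%E.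
  under eq_integral do rewrite /S decomp -/(S a k _).
  rewrite (@indep_tonelli _ _ _ _ _ _ _ P (S a k) (fun o => X o ord0 j)
    (fun z => f (z.1 + a j * z.2)))//.
  - apply: eq_integral => o _ /=.
    rewrite (@ge0_integral_gaussian_coord j (fun x => f (S a k o + a j * x)))//.
    by apply: eq_integral => z _; rewrite /F/= mulrA.
  - exact: (@indS a j).
  - apply: (measurableT_comp mf); apply: measurable_funD => //.
    exact: measurable_funM.
rewrite ih//; last exact: ltnW.
set sk := s * Num.sqrt _.
have sk0 : 0 <= sk by rewrite mulr_ge0 ?sqrtr_ge0// ltW.
rewrite /g /F/= (normal_rotation _ sk0 mf f0).
suff -> : Num.sqrt (sk ^+ 2 + (a j * s) ^+ 2) =
    s * Num.sqrt (\sum_(i < p | (i < k.+1)%N) a i ^+ 2) by [].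
rewrite decomp /sk !exprMn [a j ^+ 2 * _]mulrC -mulrDr.
rewrite sqr_sqrtr; last by apply: sumr_ge0 => i _; exact: sqr_ge0.
by rewrite sqrtrM ?sqr_ge0// sqrtr_sqr gtr0_norm.
Qed.

(** The last of the partial sums, whose laws are obtained one coordinate at a
time in [lawS]. *)
Lemma ge0_integral_gaussian_lin (a : 'I_p -> R) (f : R -> \bar R) :
  measurable_fun setT f -> (forall x, 0 <= f x)%E ->
  (\int[P]_o f (\sum_(i < p) a i * X o ord0 i)%R
   = \int[lebesgue_measure]_z
       (f (s * Num.sqrt (\sum_(i < p) a i ^+ 2) * z)%R * (normal_pdf 0 1 z)%:E))%E.
Proof.
move=> mf f0; have := lawS a (leqnn p) mf f0.
have E (F : 'I_p -> R) : \sum_(i < p | (i < p)%N) F i = \sum_(i < p) F i.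
  by apply: eq_bigl => i; exact: ltn_ord.
rewrite E; under eq_integral do rewrite /S E.
by [].
Qed.

(** The positive part is homogeneous, so the standard deviation factors out
of the integral. *)
Lemma gaussian_lin_pos_part (a : 'I_p -> R) :
  (\int[P]_o (Num.max 0 (\sum_(i < p) a i * X o ord0 i))%:E
   = (s * Num.sqrt (\sum_(i < p) a i ^+ 2) / Num.sqrt (2 * pi))%:E)%E.
Proof.
have mpos : measurable_fun setT (fun x : R => (Num.max 0 x)%:E).
  by apply/measurable_EFinP; exact: measurable_maxr.
rewrite (ge0_integral_gaussian_lin _ mpos); last first.
  by move=> x; rewrite lee_fin le_max lexx.
set c := s * _; have c0 : 0 <= c by rewrite mulr_ge0 ?sqrtr_ge0// ltW.
rewrite EFinM -normal_pos_part -ge0_integralZl//.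
- apply: eq_integral => z _; rewrite muleA; congr (_ * _)%E.
  by rewrite -EFinM maxr_pMr// mulr0.
- apply: emeasurable_funM; first exact: mpos.
  by apply/measurable_EFinP; exact: measurable_normal_pdf.
- by move=> x _; rewrite mule_ge0// lee_fin ?normal_pdf_ge0// le_max lexx.
Qed.

Lemma gaussian_coord_sqr_le j :
  (\int[P]_o (X o ord0 j ^+ 2)%:E <= (s ^+ 2)%:E)%E.
Proof.
have msq : measurable_fun setT (fun x : R => (x ^+ 2)%:E).
  by apply/measurable_EFinP; exact: measurable_funX.
rewrite (ge0_integral_gaussian_coord _ msq); last first.
  by move=> x; rewrite lee_fin sqr_ge0.
have -> : (\int[lebesgue_measure]_z (((s * z) ^+ 2)%:E * (normal_pdf 0 1 z)%:E)
    = (s ^+ 2)%:E * \int[lebesgue_measure]_z ((z ^+ 2)%:E * (normal_pdf 0 1 z : R)%:E))%E.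
  rewrite -ge0_integralZl//.
  - by apply: eq_integral => z _; rewrite muleA exprMn EFinM.
  - apply: emeasurable_funM; first exact: msq.
    by apply/measurable_EFinP; exact: measurable_normal_pdf.
  - by move=> x _; rewrite mule_ge0// lee_fin ?normal_pdf_ge0// sqr_ge0.
  - by rewrite lee_fin sqr_ge0.
rewrite -[leRHS]mule1; apply: lee_wpmul2l; first by rewrite lee_fin sqr_ge0.
exact: normal_moment2_le1.
Qed.

End gaussian_vector.

(** * Measurability of the run *)

(** A superlevel set of [F] is a countable union of boxes with rational centre
and radius, and the preimage of a box is measurable coordinate by coordinate.
Superlevel sets generate the Borel sets, hence the one-sided hypothesis. *)
Lemma measurable_cts_comp d (T : measurableType d) (R : realType) (k : nat)
    (F : 'rV[R]_k -> R) (X : T -> 'rV[R]_k) :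
  (forall (y : 'rV[R]_k) (e : R), 0 < e -> exists2 r : R, 0 < r & forall z : 'rV[R]_k,
     (forall i, `|y ord0 i - z ord0 i| < r) -> F y - e < F z) ->
  (forall i, measurable_fun setT (fun o => X o ord0 i)) ->
  measurable_fun setT (fun o => F (X o)).
Proof.
move=> cF mX.
apply: (measurability _ (RGenOInfty.measurableE R)) => // _ [_ [a ->] <-].
rewrite setTI.
pose Q (q : 'rV[rat]_k * nat) : set T :=
  [set o | forall i, `|ratr (q.1 ord0 i) - X o ord0 i| < q.2.+1%:R^-1].
pose good (q : 'rV[rat]_k * nat) := forall z : 'rV[R]_k,
  (forall i, `|ratr (q.1 ord0 i) - z ord0 i| < q.2.+1%:R^-1) -> a < F z.
have -> : (fun o => F (X o)) @^-1` `]a, +oo[ = \bigcup_(q in good) Q q.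
  apply/seteqP; split => o /=; last by case=> q gq Qo; rewrite in_itv/= andbT; exact: gq.
  rewrite in_itv/= andbT => aF.
  have e0 : 0 < F (X o) - a by rewrite subr_gt0.
  have [r r0 hr] := cF (X o) _ e0.
  have [n hn] : exists n : nat, n.+1%:R^-1 < r / 2.
    have r20 : 0 < r / 2 by rewrite divr_gt0.
    exists (Num.truncn (r / 2)^-1); rewrite invf_plt ?posrE//.
    exact: truncnS_gt.
  have hq i : exists q : rat, `|ratr q - X o ord0 i| < n.+1%:R^-1.
    have n0 : 0 < n.+1%:R^-1 :> R by rewrite invr_gt0.
    have [|q hq] := @rat_in_itvoo R (X o ord0 i - n.+1%:R^-1) (X o ord0 i + n.+1%:R^-1).
      by rewrite ltrBlDr -addrA ltrDl addr_gt0.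
    by exists q; rewrite ltr_distl; move: hq; rewrite in_itv.
  pose qv := \row_i (sval (cid (hq i))).
  have qvP i : `|ratr (qv ord0 i) - X o ord0 i| < n.+1%:R^-1.
    by rewrite mxE; exact: (svalP (cid (hq i))).
  exists (qv, n) => // z hz.
  have -> : a = F (X o) - (F (X o) - a) by rewrite subKr.
  apply: hr => i.
  rewrite (le_lt_trans (ler_distD (ratr (qv ord0 i)) _ _))// (splitr r) ltrD//.
    by rewrite distrC (lt_trans (qvP i)).
  by rewrite (lt_trans (hz i)).
have -> : \bigcup_(q in good) Q q = \bigcup_q (if `[< good q >] then Q q else set0).
  apply/seteqP; split => o [q].
    by move=> gq Qo; exists q => //; rewrite asboolT.
  by case: asboolP => // gq _ Qo; exists q.
apply: countable_bigcupT_measurable => [|q]; first exact: countableP.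
case: asboolP => // _.
have -> : Q q = \bigcap_(i in [set: 'I_k])
    ((fun o => ratr (q.1 ord0 i) - X o ord0 i) @^-1` `]- q.2.+1%:R^-1, q.2.+1%:R^-1[).
  by apply/seteqP; split => o h i; [move=> _|]; have := h i; rewrite /= in_itv/= ltr_norml//; apply.
apply: fin_bigcap_measurable; first exact: finite_finset.
move=> i _; rewrite -[X in measurable X]setTI; apply: measurable_funB => //.
Qed.

(** Two vectors are glued into one row, which reduces joint continuity in two
arguments to [measurable_cts_comp]. *)
Lemma measurable_cts_comp2 d (T : measurableType d) (R : realType) (m n : nat)
    (F : 'rV[R]_m -> 'rV[R]_n -> R) (X : T -> 'rV[R]_m) (Y : T -> 'rV[R]_n) :
  (forall (x : 'rV[R]_m) (y : 'rV[R]_n) (e : R), 0 < e ->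
   exists2 r : R, 0 < r & forall (x' : 'rV[R]_m) (y' : 'rV[R]_n),
     (forall i, `|x ord0 i - x' ord0 i| < r) ->
     (forall i, `|y ord0 i - y' ord0 i| < r) -> F x y - e < F x' y') ->
  (forall i, measurable_fun setT (fun o => X o ord0 i)) ->
  (forall i, measurable_fun setT (fun o => Y o ord0 i)) ->
  measurable_fun setT (fun o => F (X o) (Y o)).
Proof.
move=> cF mX mY.
have -> : (fun o => F (X o) (Y o)) =
    (fun o => (fun z => F (lsubmx z) (rsubmx z)) (row_mx (X o) (Y o))).
  by apply/funext => o; rewrite row_mxKl row_mxKr.
apply: (@measurable_cts_comp _ _ _ _ (fun z => F (lsubmx z) (rsubmx z))
  (fun o => row_mx (X o) (Y o))) => [z e e0|i].
  have [r r0 hr] := cF (lsubmx z) (rsubmx z) e e0.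
  by exists r => // z' hz; apply: hr => i; rewrite !mxE; exact: hz.
case: (splitP i) => j ij.
- have -> : i = lshift n j by exact: val_inj.
  by under eq_fun do rewrite row_mxEl; exact: mX.
- have -> : i = rshift m j by exact: val_inj.
  by under eq_fun do rewrite row_mxEr; exact: mY.
Qed.

Lemma le_coord_enorm (R : realType) n (x : 'rV[R]_n) i : `|x ord0 i| <= enorm x.
Proof.
rewrite /enorm -sqrtr_sqr ler_sqrt; last by apply: sumr_ge0 => j _; exact: sqr_ge0.
by rewrite (bigD1 i)//= lerDl sumr_ge0// => j _; exact: sqr_ge0.
Qed.

Lemma enorm_le_coord (R : realType) n (x : 'rV[R]_n) (r : R) : 0 <= r ->
  (forall i, `|x ord0 i| < r) -> enorm x <= n%:R * r.
Proof.
move=> r0 hx; have nr : 0 <= n%:R * r by rewrite mulr_ge0.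
rewrite -[leRHS](ger0_norm nr) -sqrtr_sqr ler_sqrt ?sqr_ge0//.
apply: (@le_trans _ _ (\sum_(i < n) r ^+ 2)).
  apply: ler_sum => i _; rewrite -[x ord0 i ^+ 2]real_normK ?num_real//.
  by rewrite lerXn2r ?nnegrE// ltW.
rewrite sumr_const card_ord -(mulr_natl (r ^+ 2)) exprMn ler_wpM2r ?sqr_ge0// -natrX ler_nat.
by case: (n) => // k; rewrite expnS expn1 leq_pmulr.
Qed.

Lemma continuous_coord (R : realType) k (F : 'rV[R]_k -> R) (y : 'rV[R]_k) (e : R) :
  continuous F -> 0 < e -> exists2 r : R, 0 < r & forall z : 'rV[R]_k,
     (forall i, `|y ord0 i - z ord0 i| < r) -> F y - e < F z.
Proof.
move=> cF e0; have /cvgrPdist_lt/(_ e e0) := cF y.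
move=> /nbhs_ballP[r /= r0 hr]; exists r => // z hz.
have : `|F y - F z| < e.
  by apply: hr; split => // i j; rewrite (ord1 i); exact: hz.
by rewrite ltr_distlC; lra.
Qed.

Lemma measurable_elipschitz d (T : measurableType d) (R : realType) m n (K : R)
    (g : 'rV[R]_m -> 'rV[R]_n) (X : T -> 'rV[R]_m) :
  0 <= K -> elipschitz K g -> (forall i, measurable_fun setT (fun o => X o ord0 i)) ->
  forall i, measurable_fun setT (fun o => g (X o) ord0 i).
Proof.
move=> K0 gK mX i.
apply: (@measurable_cts_comp _ _ _ _ (fun z => g z ord0 i) X) => // y e e0.
have k0 : 0 < K * m%:R + 1 by rewrite ltr_wpDl// mulr_ge0.
exists (e / (K * m%:R + 1)); first by rewrite divr_gt0.
move=> z hz; have := enorm_le_coord (x := y - z) (ltW (divr_gt0 e0 k0)).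
rewrite -/(GRing.zero _) => h.
have {}h : enorm (y - z) <= m%:R * (e / (K * m%:R + 1)) by apply: h => j; rewrite !mxE.
have := le_coord_enorm (g y - g z) i; have := gK y z; rewrite !mxE => g1 g2.
have h2 := ler_wpM2l K0 h.
have h3 : K * (m%:R * (e / (K * m%:R + 1))) = e - e / (K * m%:R + 1) by field; rewrite gt_eqF.
have h4 : 0 < e / (K * m%:R + 1) by rewrite divr_gt0.
have := ler_norm (g y ord0 i - g z ord0 i); lra.
Qed.

Section run_measurability.
Context d (T : measurableType d) (R : realType) (n p q r : nat).
Variables (f : 'rV[R]_n -> 'rV[R]_p -> 'rV[R]_r -> 'rV[R]_n)
  (h : 'rV[R]_n -> 'rV[R]_r -> 'rV[R]_q) (w : 'rV[R]_r)
  (Psi : 'rV[R]_p -> 'rV[R]_q -> R) (Lfx Lfu Lhx LPsi : R).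
Hypotheses (Lfx0 : 0 <= Lfx) (Lfu0 : 0 <= Lfu) (Lhx0 : 0 <= Lhx) (LPsi0 : 0 <= LPsi)
  (hfx : forall u, elipschitz Lfx (fun x => f x u w))
  (hfu : forall x, elipschitz Lfu (fun u => f x u w))
  (hhx : elipschitz Lhx (fun x => h x w))
  (hPsi : forall u y y', `|Psi u y - Psi u y'| <= LPsi * enorm (y - y'))
  (hcont : forall x, continuous (fun u => Psi u (h (f x u w) w))).

Let coord_meas k (X : T -> 'rV[R]_k) := forall i, measurable_fun setT (fun o => X o ord0 i).

Lemma measurable_plant (X : T -> 'rV[R]_n) (U : T -> 'rV[R]_p) :
  coord_meas X -> coord_meas U -> coord_meas (fun o => f (X o) (U o) w).
Proof.
move=> mX mU i; apply: (@measurable_cts_comp2 _ _ _ _ _ (fun x u => f x u w ord0 i)) => //.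
move=> x u e e0.
have k0 : 0 < Lfx * n%:R + Lfu * p%:R + 1.
  by rewrite ltr_wpDl// addr_ge0// mulr_ge0.
pose r0 := e / (Lfx * n%:R + Lfu * p%:R + 1).
have r00 : 0 < r0 by rewrite divr_gt0.
exists r0 => // x' u' hx' hu'.
have hx : enorm (x - x') <= n%:R * r0 by apply: enorm_le_coord => [|j]; rewrite ?ltW// !mxE.
have hu : enorm (u - u') <= p%:R * r0 by apply: enorm_le_coord => [|j]; rewrite ?ltW// !mxE.
have := le_coord_enorm (f x u w - f x' u w) i; have := hfx u x x'.
have := le_coord_enorm (f x' u w - f x' u' w) i; have := hfu x' u u'.
rewrite !mxE => a1 a2 b1 b2.
have := ler_norm (f x u w ord0 i - f x' u w ord0 i).
have := ler_norm (f x' u w ord0 i - f x' u' w ord0 i).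
have h1 := ler_wpM2l Lfx0 hx; have h2 := ler_wpM2l Lfu0 hu.
have h3 : Lfx * (n%:R * r0) + Lfu * (p%:R * r0) = e - r0 by rewrite /r0; field; rewrite gt_eqF.
lra.
Qed.

(** The cost is Lipschitz in the state uniformly in the input, so continuity in
the input at each fixed state becomes joint continuity. *)
Lemma measurable_measured_cost (X : T -> 'rV[R]_n) (U : T -> 'rV[R]_p) :
  coord_meas X -> coord_meas U ->
  measurable_fun setT (fun o => Psi (U o) (h (f (X o) (U o) w) w)).
Proof.
move=> mX mU.
apply: (@measurable_cts_comp2 _ _ _ _ _ (fun x u => Psi u (h (f x u w) w))) => //.
move=> x u e e0; have e20 : 0 < e / 2 by rewrite divr_gt0.
have [r1 r10 hr1] := continuous_coord u (@hcont x) e20.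
pose K := LPsi * (Lhx * Lfx) * n%:R + 1.
have K0 : 0 < K by rewrite ltr_wpDl// !mulr_ge0.
pose r2 := e / 2 / K.
have r20 : 0 < r2 by rewrite divr_gt0.
exists (Num.min r1 r2); first by rewrite lt_min r10.
move=> x' u' hx' hu'.
have hx : enorm (x - x') <= n%:R * r2.
  apply: enorm_le_coord => [|j]; first exact: ltW.
  by rewrite !mxE; have := hx' j; rewrite lt_min => /andP[].
have c1 : Psi u (h (f x u w) w) - e / 2 < Psi u' (h (f x u' w) w).
  by apply: hr1 => j; have := hu' j; rewrite lt_min => /andP[].
have c2 : Psi u' (h (f x u' w) w) - Psi u' (h (f x' u' w) w) <= e / 2 - r2.
  apply: (le_trans (ler_norm _)); apply: (le_trans (hPsi _ _ _)).
  have -> : e / 2 - r2 = LPsi * (Lhx * (Lfx * (n%:R * r2))).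
    by rewrite /r2 /K; field; rewrite -/K gt_eqF.
  apply: ler_wpM2l => //; apply: (le_trans (hhx _ _)); apply: ler_wpM2l => //.
  by apply: (le_trans (hfx _ _ _)); apply: ler_wpM2l.
lra.
Qed.

Variables (delta : nat -> R) (u0 : 'rV[R]_p) (x0 : 'rV[R]_n)
  (v : nat -> T -> 'rV[R]_p) (u : nat -> T -> 'rV[R]_p)
  (x : nat -> T -> 'rV[R]_n) (y : nat -> T -> 'rV[R]_q).
Hypothesis hrun : forall o, direct_search f h Psi w delta u0 x0
            (v ^~ o) (u ^~ o) (x ^~ o) (y ^~ o).

Lemma measured_costE t o : Psi (u t o) (y t.+1 o) = Psi (u t o) (h (f (x t o) (u t o) w) w).
Proof. by have [_ hx hy _ _] := hrun o; rewrite hy hx. Qed.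

Lemma probe_measurable t : ~~ odd t -> coord_meas (v t) ->
  coord_meas (u t) -> coord_meas (x t) ->
  coord_meas (u t.+1) /\ coord_meas (x t.+1).
Proof.
move=> et mv mu mx; split.
  move=> i; have -> : (fun o => u t.+1 o ord0 i) =
      (fun o => u t o ord0 i + delta t * v t o ord0 i).
    by apply/funext => o; have [_ _ _ hu _] := hrun o; rewrite hu// !mxE.
  by apply: measurable_funD => //; apply: measurable_funM.
have -> : x t.+1 = (fun o => f (x t o) (u t o) w).
  by apply/funext => o; have [_ hx _ _ _] := hrun o; rewrite hx.
exact: measurable_plant.
Qed.

(** The sigma-algebra on [T] is arbitrary. It is used both with the one of the
sample space and with the one generated by the directions drawn before
period [k], which expresses that the run is adapted. *)
Lemma run_measurable k :
  (forall s, ~~ odd s -> (s < k.*2)%N -> coord_meas (v s)) ->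
  coord_meas (u k.*2) /\ coord_meas (x k.*2).
Proof.
elim: k => [|k ih] mv.
  have -> : u 0.*2 = cst u0 by apply/funext => o; have [[]] := hrun o.
  have -> : x 0.*2 = cst x0 by apply/funext => o; have [[]] := hrun o.
  by split => i; exact: measurable_cst.
have ek : ~~ odd k.*2 by rewrite odd_double.
have [|mu mx] := ih; first by move=> s es sk; apply: mv => //; rewrite doubleS (leq_trans sk)// !leqW.
have [|mu1 mx1] := probe_measurable ek _ mu mx; first by apply: mv; rewrite ?doubleS.
split; rewrite doubleS; last first.
  have -> : x k.*2.+2 = (fun o => f (x k.*2.+1 o) (u k.*2.+1 o) w).
    by apply/funext => o; have [_ hx _ _ _] := hrun o; rewrite hx.
  exact: measurable_plant.
move=> i.
have -> : (fun o => u k.*2.+2 o ord0 i) = (fun o =>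
    if Psi (u k.*2.+1 o) (h (f (x k.*2.+1 o) (u k.*2.+1 o) w) w)
       <= Psi (u k.*2 o) (h (f (x k.*2 o) (u k.*2 o) w) w)
    then u k.*2.+1 o ord0 i else u k.*2 o ord0 i).
  apply/funext => o; have [_ _ _ _ hu] := hrun o.
  by rewrite hu// !measured_costE; case: ifP.
apply: measurable_fun_ifT => //.
by apply: measurable_fun_ler; exact: measurable_measured_cost.
Qed.

End run_measurability.

(** * The descent inequality *)

Lemma sqr_enorm (R : realType) n (x : 'rV[R]_n) :
  enorm x ^+ 2 = \sum_(i < n) x ord0 i ^+ 2.
Proof. by rewrite sqr_sqrtr// sumr_ge0// => i _; exact: sqr_ge0. Qed.

Lemma diff_gradient (R : realType) n (F : 'rV[R]_n -> R) (x v : 'rV[R]_n) :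
  differentiable F x ->
  'd F x v = \sum_(i < n) gradient F x ord0 i * v ord0 i.
Proof.
move=> dF; rewrite {1}(row_sum_delta v) linear_sum; apply: eq_bigr => i _.
by rewrite linearZ/= mxE deriveE// mulrC.
Qed.

Lemma is_derive_line (R : realType) n (F : 'rV[R]_n -> R) (x v : 'rV[R]_n) (s : R) :
  differentiable F (x + s *: v) ->
  is_derive s 1 (fun t : R => F (x + t *: v))
    (\sum_(i < n) gradient F (x + s *: v) ord0 i * v ord0 i).
Proof.
move=> dF; rewrite -diff_gradient//.
have [dl dlE] := is_diffD (is_diff_cst x s) (is_diff_scalel s v).
have dFl : differentiable (F \o (fun t : R => x + t *: v)) s.
  by apply: differentiable_comp.
split; first exact: diff_derivable.
rewrite deriveE// diff_comp//=.
by rewrite [X in 'd F _ (X _)]dlE/= fctE/= add0r scale1r.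
Qed.

(** The mean value theorem for [F (x + s v)] minus its quadratic upper bound:
the derivative of the difference at [s = c] is
[<gradient F (x + c v) - gradient F x, v> - L c |v|^2], which is nonpositive by
the Lipschitz bound and the inequality [2 <d, v> <= |d|^2 / (L c) + L c |v|^2]. *)
Lemma descent_lemma (R : realType) n (F : 'rV[R]_n -> R) (L : R) (x v : 'rV[R]_n) :
  0 < L -> (forall z, differentiable F z) -> elipschitz L (gradient F) ->
  F (x + v) <= F x + \sum_(i < n) gradient F x ord0 i * v ord0 i + L / 2 * enorm v ^+ 2.
Proof.
move=> L0 dF gL.
set g := \sum_(i < n) _.
(* F along the segment, minus its quadratic upper bound *)
pose psi (s : R) := F (x + s *: v) - s * g - L / 2 * enorm v ^+ 2 * s ^+ 2.
pose psi' (s : R) := \sum_(i < n) gradient F (x + s *: v) ord0 i * v ord0 i - g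
  - L * enorm v ^+ 2 * s.
have dpsi (s : R) : is_derive s 1 psi (psi' s).
  have := is_derive_line (dF (x + s *: v)) => dl.
  rewrite /psi /psi'.
  apply: is_derive_eq.
  by rewrite /GRing.scale/=; field.
have [|c c01 mvt] := @MVT R psi psi' 0 1 ltr01 (fun s _ => dpsi s).
  by apply: derivable_within_continuous => s _; have [] := dpsi s.
move: c01; rewrite in_itv/= => /andP[c0 c1].
have psi'0 : psi' c <= 0.
  pose dd := gradient F (x + c *: v) - gradient F x.
  have e1 : psi' c = \sum_(i < n) dd ord0 i * v ord0 i - L * enorm v ^+ 2 * c.
    rewrite /psi' /g -sumrB; congr (_ - _); apply: eq_bigr => i _.
    by rewrite !mxE; ring.
  have hd : enorm dd <= L * c * enorm v.
    have := gL (x + c *: v) x; rewrite addrAC subrr add0r => /le_trans; apply.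
    rewrite -mulrA ler_pM2l// /enorm.
    under eq_bigr do rewrite mxE exprMn.
    by rewrite -mulr_sumr sqrtrM ?sqr_ge0// sqrtr_sqr gtr0_norm.
  have Lc : 0 < L * c by rewrite mulr_gt0.
  have hd2 : enorm dd ^+ 2 <= (L * c) ^+ 2 * enorm v ^+ 2.
    by rewrite -exprMn lerXn2r// nnegrE ?mulr_ge0// ?sqrtr_ge0// ltW.
  have amgm : 2 * (L * c) * (\sum_(i < n) dd ord0 i * v ord0 i)
      <= enorm dd ^+ 2 + (L * c) ^+ 2 * enorm v ^+ 2.
    rewrite !sqr_enorm !mulr_sumr -big_split/=; apply: ler_sum => i _.
    have := sqr_ge0 (dd ord0 i - L * c * v ord0 i); lra.
  rewrite e1; move: amgm hd2; set s := \sum_(i < n) _; nra.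
move: mvt; rewrite /psi !scale1r !scale0r !addr0 subr0 expr0n expr1n/=.
lra.
Qed.

(** * One period of the search *)

Lemma measurable_id_g_sigma d (Omega : measurableType d) (G : set (set Omega)) :
  G `<=` measurable -> measurable_fun setT (idfun : Omega -> g_sigma_algebraType G).
Proof.
move=> Gm _ A mA; rewrite setTI.
exact: (smallest_sub (@sigma_algebra_measurable _ Omega) Gm).
Qed.

(** [Y] is determined by [A] and [X] by [B], and [A] is independent of [B], so
[Y] can be frozen while [X] is integrated. *)
Lemma expected_slope d (Omega : measurableType d) (R : realType)
    (P : probability Omega R) (p : nat) (s : R) (X Y : Omega -> 'rV[R]_p)
    (A B : set (set Omega)) :
  0 < s -> isotropic_gaussian P s X -> A `<=` measurable -> B `<=` measurable ->
  (forall C D, <<s A >> C -> <<s B >> D -> P (C `&` D) = (P C * P D)%E) ->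
  (forall i, measurable_fun (setT : set (g_sigma_algebraType A)) (fun o => Y o ord0 i)) ->
  (forall i, measurable_fun (setT : set (g_sigma_algebraType B)) (fun o => X o ord0 i)) ->
  (\int[P]_o (Num.max 0 (\sum_(i < p) Y o ord0 i * X o ord0 i))%:E
   = \int[P]_o ((s / Num.sqrt (2 * pi))%:E * (enorm (Y o))%:E))%E.
Proof.
move=> s0 gX Am Bm ind mY mX.
pose T1 := g_sigma_algebraType A; pose T2 := g_sigma_algebraType B.
pose F (z : T1 * T2) : \bar R :=
  (Num.max 0 (\sum_(i < p) Y z.1 ord0 i * X z.2 ord0 i))%:E.
have mF : measurable_fun setT F.
  apply/measurable_EFinP; apply: measurable_maxr; first exact: measurable_cst.
  apply: measurable_sum => i; apply: measurable_funM.
    exact: (measurableT_comp (mY i)).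
  exact: (measurableT_comp (mX i)).
have F0 z : (0 <= F z)%E by rewrite lee_fin le_max lexx.
rewrite (@indep_tonelli _ _ _ Omega T1 T2 R P idfun idfun F (measurable_id_g_sigma Am)
  (measurable_id_g_sigma Bm) ind mF F0).
apply: eq_integral => o _; rewrite /F/=.
by rewrite (gaussian_lin_pos_part s0 gX) -EFinM mulrAC.
Qed.

(** If the candidate is accepted, its true value is below its measurement plus
an error, hence below the other measurement plus that error, hence below the
other true value plus both errors. A rejection is symmetric. *)
Lemma accepted_value_le (R : realType) (V : Type) (Phi : V -> R) (u u' : V) (m m' : R) :
  Phi (if m' <= m then u' else u)
  <= Num.min (Phi u) (Phi u') + (`|m - Phi u| + `|m' - Phi u'|).
Proof.
have h1 := ler_norm (m - Phi u); have h2 : - `|m - Phi u| <= m - Phi u by exact: lerNnormlW.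
have h3 := ler_norm (m' - Phi u'); have h4 : - `|m' - Phi u'| <= m' - Phi u' by exact: lerNnormlW.
have n1 := normr_ge0 (m - Phi u); have n2 := normr_ge0 (m' - Phi u').
by rewrite minEle; case: ifP => a; case: ifP => b; lra.
Qed.

Lemma gaussian_sqr_enorm_le1 d (Omega : measurableType d) (R : realType)
    (P : probability Omega R) (p : nat) (X : Omega -> 'rV[R]_p) : (0 < p)%N ->
  isotropic_gaussian P (Num.sqrt p%:R^-1) X ->
  (\int[P]_o (enorm (X o) ^+ 2)%:E <= 1)%E.
Proof.
move=> p0 gX; have [mX _] := gX.
have s0 : 0 < Num.sqrt (p%:R^-1 : R) by rewrite sqrtr_gt0 invr_gt0 ltr0n.
under eq_integral do rewrite sqr_enorm -sumEFin.
rewrite ge0_integral_sum//; last 2 first.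
- by move=> i; apply/measurable_EFinP; exact: measurable_funX.
- by move=> i o _; rewrite lee_fin sqr_ge0.
apply: (@le_trans _ _ (\sum_(i < p) (p%:R^-1 : R)%:E)%E).
  apply: lee_sum => i _; apply: le_trans (gaussian_coord_sqr_le s0 gX i) _.
  by rewrite lee_fin sqr_sqrtr// invr_ge0.
by rewrite sumEFin sumr_const card_ord -(mulr_natl (p%:R^-1)) divff// pnatr_eq0 -lt0n.
Qed.

Lemma enormN (R : realType) k (x : 'rV[R]_k) : enorm (- x) = enorm x.
Proof.
by rewrite /enorm; congr Num.sqrt; apply: eq_bigr => i _; rewrite mxE sqrrN.
Qed.

Lemma measurable_enorm d (T : measurableType d) (R : realType) k (X : T -> 'rV[R]_k) :
  (forall i, measurable_fun setT (fun o => X o ord0 i)) ->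
  measurable_fun setT (fun o => enorm (X o)).
Proof.
move=> mX; have ms : measurable_fun setT (Num.sqrt : R -> R).
  by apply: continuous_measurable_fun; exact: sqrt_continuous.
apply: (measurableT_comp ms).
by apply: measurable_sum => i; exact: measurable_funX.
Qed.

Section two_point_search.
Context (R : realType) (n p q r : nat) (p0 : (0 < p)%N).
Variables (f : 'rV[R]_n -> 'rV[R]_p -> 'rV[R]_r -> 'rV[R]_n)
  (h : 'rV[R]_n -> 'rV[R]_r -> 'rV[R]_q) (w : 'rV[R]_r)
  (Psi : 'rV[R]_p -> 'rV[R]_q -> R) (Lfx Lfu Lhx LPsi : R).
Hypotheses (Lfx0 : 0 <= Lfx) (Lfu0 : 0 <= Lfu) (Lhx0 : 0 <= Lhx) (LPsi0 : 0 <= LPsi)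
  (hfx : forall u, elipschitz Lfx (fun x => f x u w))
  (hfu : forall x, elipschitz Lfu (fun u => f x u w))
  (hhx : elipschitz Lhx (fun x => h x w))
  (hPsi : forall u y y', `|Psi u y - Psi u y'| <= LPsi * enorm (y - y'))
  (hcont : forall x, continuous (fun u => Psi u (h (f x u w) w))).
Variables (Phi : 'rV[R]_p -> R) (L Philow : R).
Hypotheses (L0 : 0 < L) (dPhi : forall u, differentiable Phi u)
  (gPhi : elipschitz L (gradient Phi)) (lowP : forall u, Philow <= Phi u).
Context d (Omega : measurableType d) (P : probability Omega R).
Variables (v : nat -> Omega -> 'rV[R]_p) (delta : nat -> R)
  (u0 : 'rV[R]_p) (x0 : 'rV[R]_n) (u : nat -> Omega -> 'rV[R]_p)
  (x : nat -> Omega -> 'rV[R]_n) (y : nat -> Omega -> 'rV[R]_q).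
Hypotheses (hv : random_directions P v)
  (hrun : forall o, direct_search f h Psi w delta u0 x0
            (v ^~ o) (u ^~ o) (x ^~ o) (y ^~ o)).

Let err t o := oracle_error Psi Phi (u ^~ o) (y ^~ o) t.

(** The slope term is positive only when the probe goes downhill to first
order; the minimum in [accepted_value_le] is what discards the uphill probes. *)
Lemma search_step_pointwise t o : ~~ odd t -> 0 <= delta t ->
  (Phi (u t.+2 o) - Philow)
  + delta t * Num.max 0 (\sum_(i < p) (- gradient Phi (u t o)) ord0 i * v t o ord0 i)
  <= (Phi (u t o) - Philow) + L / 2 * delta t ^+ 2 * enorm (v t o) ^+ 2
     + (err t o + err t.+1 o).
Proof.
move=> et dt; have [_ _ _ hu1 hu2] := hrun o.
have := accepted_value_le Phi (u t o) (u t.+1 o) (Psi (u t o) (y t.+1 o))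
  (Psi (u t.+1 o) (y t.+2 o)).
rewrite -hu2// -/(err t o) -/(err t.+1 o).
have := descent_lemma (u t o) (delta t *: v t o) L0 dPhi gPhi.
rewrite -hu1// sqr_enorm.
have -> : \sum_(i < p) (delta t *: v t o) ord0 i ^+ 2 = delta t ^+ 2 * enorm (v t o) ^+ 2.
  by rewrite sqr_enorm mulr_sumr; apply: eq_bigr => i _; rewrite mxE exprMn.
have -> : \sum_(i < p) gradient Phi (u t o) ord0 i * (delta t *: v t o) ord0 i =
    - (delta t * \sum_(i < p) (- gradient Phi (u t o)) ord0 i * v t o ord0 i).
  rewrite mulr_sumr -sumrN; apply: eq_bigr => i _; rewrite !mxE; ring.
have q0 : 0 <= L / 2 * (delta t ^+ 2 * enorm (v t o) ^+ 2).
  by apply: mulr_ge0; [rewrite divr_ge0 ?ltW|rewrite mulr_ge0 ?sqr_ge0].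
move: (\sum_(i < p) _) => S; rewrite mulrA in q0 *.
rewrite /err /oracle_error minEle.
by case: (leP 0 S) => S0; case: (leP (Phi (u t o)) (Phi (u t.+1 o))) => hm; rewrite ?mulr0; lra.
Qed.

Let mv (t : nat) (et : ~~ odd t) i : measurable_fun setT (fun o => v t o ord0 i).
Proof. by have [[mX _] _] := hv et; exact: mX. Qed.

Let run_meas t (et : ~~ odd t) :
  (forall i, measurable_fun setT (fun o => u t o ord0 i)) /\
  (forall i, measurable_fun setT (fun o => x t o ord0 i)).
Proof.
have -> : t = t./2.*2 by rewrite -[LHS]odd_double_half (negbTE et).
apply: (@run_measurable _ Omega _ _ _ _ _ f h w Psi Lfx Lfu Lhx LPsi
  _ _ _ _ _ _ _ _ _ delta u0 x0 v u x y hrun) => // s es _ i; exact: mv.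
Qed.

Let mPhi (U : Omega -> 'rV[R]_p) : (forall i, measurable_fun setT (fun o => U o ord0 i)) ->
  measurable_fun setT (fun o => Phi (U o)).
Proof.
move=> mU; apply: measurable_cts_comp mU => z e e0; apply: continuous_coord => //.
by move=> z'; apply: differentiable_continuous; exact: dPhi.
Qed.

Let merr t : measurable_fun setT (err t).
Proof.
have main s : (forall i, measurable_fun setT (fun o => u s o ord0 i)) ->
    (forall i, measurable_fun setT (fun o => x s o ord0 i)) -> measurable_fun setT (err s).
  move=> mu mx; rewrite /err /oracle_error; apply: measurableT_comp => //.
  apply: measurable_funB; last exact: mPhi.
  under eq_fun do rewrite (measured_costE hrun).
  exact: (@measurable_measured_cost _ _ _ _ _ _ _ f h w Psi Lfx Lhx LPsi).
have [ot|et] := boolP (odd t); last by have [] := run_meas et; exact: main.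
case: t ot => // t /= et; have [mu mx] := run_meas et.
have [mu1 mx1] := @probe_measurable _ _ _ _ _ _ _ f h w Psi Lfx Lfu Lfx0 Lfu0 hfx hfu
  delta u0 x0 v u x y hrun t et (mv et) mu mx.
exact: main.
Qed.

Let mPhilow t : ~~ odd t -> measurable_fun setT (fun o => (Phi (u t o) - Philow)%:E).
Proof.
move=> et; apply/measurable_EFinP; apply: measurable_funB => //; apply: mPhi.
by have [] := run_meas et.
Qed.

Let mgrad t : ~~ odd t -> measurable_fun setT (fun o => enorm (gradient Phi (u t o))).
Proof.
move=> et; have [mu _] := run_meas et; apply: measurable_enorm.
exact: (@measurable_elipschitz _ _ _ _ _ L (gradient Phi) _ (ltW L0) gPhi mu).
Qed.

(** The run up to time [t] is measurable for the sigma-algebra of the earlier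
directions, of which [v t] is independent. The half-normal mean
[1 / sqrt (2 pi)] times the standard deviation [1 / sqrt p] of a coordinate
gives the constant. *)
Lemma expected_probe_slope t : ~~ odd t ->
  (\int[P]_o (Num.max 0 (\sum_(i < p) (- gradient Phi (u t o)) ord0 i * v t o ord0 i))%:E
   = (Num.sqrt (2 * pi * p%:R))^-1%:E * \int[P]_o (enorm (gradient Phi (u t o)))%:E)%E.
Proof.
move=> et; have [gX ind] := hv et.
pose sig (S : set nat) := \bigcup_(s in S) \bigcup_(i in [set: 'I_p])
  preimage_set_system setT (fun o => v s o ord0 i) measurable.
pose past : set nat := [set s | ~~ odd s /\ (s < t)%N].
have sigm (S : set nat) : (forall s, S s -> ~~ odd s) -> sig S `<=` measurable.
  by move=> Se _ [s Ss [i _ [C mC <-]]]; apply: mv => //; exact: Se.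
have vsig (S : set nat) s i : S s ->
    measurable_fun (setT : set (g_sigma_algebraType (sig S))) (fun o => v s o ord0 i).
  move=> Ss _ C mC; apply: sub_sigma_algebra; exists s => //; exists i => //.
  by exists C.
have [mU _] : (forall i, measurable_fun (setT : set (g_sigma_algebraType (sig past)))
      (fun o => u t o ord0 i)) /\
    (forall i, measurable_fun (setT : set (g_sigma_algebraType (sig past)))
      (fun o => x t o ord0 i)).
  have te : t = t./2.*2 by rewrite -[LHS]odd_double_half (negbTE et).
  rewrite te; apply: (@run_measurable _ (g_sigma_algebraType (sig past)) _ _ _ _ _
    f h w Psi Lfx Lfu Lhx LPsi _ _ _ _ _ _ _ _ _ delta u0 x0 v u x y hrun) => // s es.
  by rewrite -te => st i; apply: vsig; split.
have s0 : 0 < Num.sqrt (p%:R^-1 : R) by rewrite sqrtr_gt0 invr_gt0 ltr0n.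
rewrite (@expected_slope _ _ _ P _ _ (v t) (fun o => - gradient Phi (u t o))
  (sig past) (sig [set t]) s0 gX).
- have -> : Num.sqrt (p%:R^-1) / Num.sqrt (2 * pi) = (Num.sqrt (2 * pi * p%:R))^-1 :> R.
    rewrite [Num.sqrt (2 * pi * _)]sqrtrM ?mulr_ge0 ?pi_ge0// sqrtrV ?ler0n// invfM.
    by rewrite mulrC.
  under eq_integral do rewrite enormN.
  rewrite ge0_integralZl//; first by apply/measurable_EFinP; exact: mgrad.
  by move=> o _; rewrite lee_fin sqrtr_ge0.
- by apply: sigm => s [].
- by apply: sigm => s ->.
- by move=> C D sC sD; rewrite setIC muleC; exact: ind.
- move=> i; under eq_fun do rewrite mxE; apply: measurableT_comp => //.
  exact: (@measurable_elipschitz _ _ _ _ _ L (gradient Phi) _ (ltW L0) gPhi mU).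
- by move=> i; exact: vsig.
Qed.

(** [search_step_pointwise] integrated term by term, with [E|v|^2 <= 1]. *)
Lemma expected_step t : ~~ odd t -> 0 <= delta t ->
  (\int[P]_o (Phi (u t.+2 o) - Philow)%:E
   + (delta t / Num.sqrt (2 * pi * p%:R))%:E
     * \int[P]_o (enorm (gradient Phi (u t o)))%:E
   <= \int[P]_o (Phi (u t o) - Philow)%:E + (L / 2 * delta t ^+ 2)%:E
      + ('E_P[err t] + 'E_P[err t.+1]))%E.
Proof.
move=> et dt; have [gX _] := hv et.
have et2 : ~~ odd t.+2 by rewrite /= negbK.
have [mu _] := run_meas et.
rewrite unlock.
pose S := fun o => Num.max 0 (\sum_(i < p) (- gradient Phi (u t o)) ord0 i * v t o ord0 i).
have S0 o : 0 <= S o by rewrite le_max lexx.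
have mS : measurable_fun setT S.
  apply: measurable_maxr; first exact: measurable_cst.
  apply: measurable_sum => i; apply: measurable_funM; last exact: mv.
  under eq_fun do rewrite mxE; apply: measurableT_comp => //.
  exact: (@measurable_elipschitz _ _ _ _ _ L (gradient Phi) _ (ltW L0) gPhi mu).
have c0 : 0 <= L / 2 * delta t ^+ 2 by rewrite mulr_ge0 ?sqr_ge0// divr_ge0// ltW.
have low0 (z : 'rV[R]_p) : (0 <= (Phi z - Philow)%:E)%E by rewrite lee_fin subr_ge0.
have err0 s o : (0 <= (err s o)%:E)%E by rewrite lee_fin normr_ge0.
have mE s : measurable_fun setT (fun o => (err s o)%:E).
  by apply/measurable_EFinP; exact: merr.
have mSe : measurable_fun setT (fun o => (delta t * S o)%:E).
  by apply/measurable_EFinP; apply: measurable_funM.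
have mV : measurable_fun setT (fun o => (enorm (v t o) ^+ 2)%:E).
  apply/measurable_EFinP; apply: measurable_funX; apply: measurable_enorm => i; exact: mv.
have -> : ((delta t / Num.sqrt (2 * pi * p%:R))%:E
    * \int[P]_o (enorm (gradient Phi (u t o)))%:E = \int[P]_o (delta t * S o)%:E)%E.
  rewrite EFinM -muleA -expected_probe_slope// -ge0_integralZl//.
    by apply/measurable_EFinP; exact: mS.
  by move=> o _; rewrite lee_fin; exact: S0.
have mlow := mPhilow et; have mlow2 := mPhilow et2.
have mq : measurable_fun setT
    (fun o => ((L / 2 * delta t ^+ 2)%:E * (enorm (v t o) ^+ 2)%:E)%E).
  exact: emeasurable_funM.
have q0 o : (0 <= (L / 2 * delta t ^+ 2)%:E * (enorm (v t o) ^+ 2)%:E)%E.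
  by rewrite -EFinM lee_fin mulr_ge0// sqr_ge0.
have dS0 o : (0 <= (delta t * S o)%:E)%E by rewrite lee_fin mulr_ge0.
apply: (@le_trans _ _ (\int[P]_o ((Phi (u t o) - Philow)%:E +
  ((L / 2 * delta t ^+ 2)%:E * (enorm (v t o) ^+ 2)%:E) +
  ((err t o)%:E + (err t.+1 o)%:E)))%E).
  rewrite -ge0_integralD//; apply: ge0_le_integral => //.
  - by move=> o _; apply: adde_ge0.
  - exact: emeasurable_funD.
  - by apply: emeasurable_funD; apply: emeasurable_funD.
  - move=> o _; rewrite -!EFinM -!EFinD lee_fin; exact: search_step_pointwise.
rewrite ge0_integralD//; last 4 first.
- by move=> o _; apply: adde_ge0.
- exact: emeasurable_funD.
- by move=> o _; apply: adde_ge0.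
- exact: emeasurable_funD.
rewrite !ge0_integralD//; apply: leeD => //; apply: leeD => //.
rewrite ge0_integralZl//; last by move=> o _; rewrite lee_fin sqr_ge0.
rewrite -[leRHS]mule1; apply: lee_wpmul2l; first by rewrite lee_fin.
exact: gaussian_sqr_enorm_le1.
Qed.

End two_point_search.

(** * Convergence *)

(** The induction carries the term [a N] on the left and drops it at the end. It
only adds inequalities and never subtracts, so infinite values do no harm. *)
Lemma telescope_le (R : realType) (a g : nat -> \bar R) (c e : nat -> R) (N : nat) :
  (forall k, 0 <= a k)%E -> (forall k, 0 <= g k)%E -> (forall k, 0 <= c k) ->
  (forall k, a k.+1 + (c k)%:E * g k <= a k + (e k)%:E)%E ->
  (\sum_(k < N) (c k)%:E * g k <= a 0%N + (\sum_(k < N) e k)%:E)%E.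
Proof.
move=> a0 g0 c0 step.
suff : (a N + \sum_(k < N) (c k)%:E * g k <= a 0%N + (\sum_(k < N) e k)%:E)%E.
  by apply: le_trans; rewrite leeDr.
elim: N => [|N ih]; first by rewrite !big_ord0 !adde0.
rewrite !big_ord_recr/= addeCA EFinD.
apply: (le_trans (leeD (lexx _) (step N))).
rewrite addeA [leRHS]addeA; apply: leeD => //.
by rewrite addeC.
Qed.

Theorem theorem4p14 (R : realType) (n p q r : nat) (hp : (0 < p)%N)
  (f : 'rV[R]_n -> 'rV[R]_p -> 'rV[R]_r -> 'rV[R]_n)
  (h : 'rV[R]_n -> 'rV[R]_r -> 'rV[R]_q)
  (w : 'rV[R]_r)
  (Lfx Lfu Lfw Lhx Lhw : R)
  (hLfx : 0 < Lfx < 1) (hLfu : 0 <= Lfu) (hLfw : 0 <= Lfw)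
  (hLhx : 0 <= Lhx) (hLhw : 0 <= Lhw)
  (hfx : forall u w', elipschitz Lfx (fun x => f x u w'))
  (hfu : forall x w', elipschitz Lfu (fun u => f x u w'))
  (hfw : forall x u, elipschitz Lfw (fun w' => f x u w'))
  (hhx : forall w', elipschitz Lhx (fun x => h x w'))
  (hhw : forall x, elipschitz Lhw (fun w' => h x w'))
  (xss : 'rV[R]_p -> 'rV[R]_r -> 'rV[R]_n)
  (hxss : steady_state_map f xss)
  (Psi : 'rV[R]_p -> 'rV[R]_q -> R) (LPsi : R) (hLPsi : 0 <= LPsi)
  (hPsi : forall u y y', `|Psi u y - Psi u y'| <= LPsi * enorm (y - y'))
  (Phi : 'rV[R]_p -> R) (hPhi : Phi = reduced_cost Psi h xss w)
  (L : R) (hL : 0 < L)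
  (hdiff : forall u, differentiable Phi u)
  (hgrad : elipschitz L (gradient Phi))
  (Philow : R) (hlow : forall u, Philow <= Phi u)
  (hcont : forall x, continuous (fun u => Psi u (h (f x u w) w)))
  (d : measure_display) (Omega : measurableType d) (P : probability Omega R)
  (v : nat -> Omega -> 'rV[R]_p) (hv : random_directions P v)
  (delta : nat -> R)
  (hdelta : forall t, ~~ odd t -> delta t = 1 / Num.sqrt (t.+1)%:R)
  (u0 : 'rV[R]_p) (x0 : 'rV[R]_n)
  (u : nat -> Omega -> 'rV[R]_p) (x : nat -> Omega -> 'rV[R]_n)
  (y : nat -> Omega -> 'rV[R]_q)
  (hrun : forall o, direct_search f h Psi w delta u0 x0
            (v ^~ o) (u ^~ o) (x ^~ o) (y ^~ o))
  (c0 cb rho : R) (hc0 : 0 <= c0) (hcb : 0 <= cb) (hrho : 0 < rho < 1)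
  (herr : forall t, ~~ odd t ->
     ('E_P[fun o => oracle_error Psi Phi (u ^~ o) (y ^~ o) t]
      + 'E_P[fun o => oracle_error Psi Phi (u ^~ o) (y ^~ o) t.+1]
      <= (c0 * rho ^+ t./2 + cb * delta t)%:E)%E)
  (eps : R) (heps : 0 < eps)
  (heps_cb : 16 * cb * (Num.sqrt 2 + 1) * Num.sqrt (2 * pi * p%:R) <= eps)
  (T : nat) (hTeven : ~~ odd T) (hT2 : (2 <= T)%N)
  (hT : Num.max
     (2 * pi * p%:R * (Num.sqrt 2 + 1) ^+ 2 / eps ^+ 2
        * (4 * (Phi u0 - Philow) + L) ^+ 2)
     (8 * pi * p%:R * (Num.sqrt 2 + 1) ^+ 2 * L ^+ 2 / eps ^+ 2
        * ln (2 * (Num.sqrt 2 + 1) * Num.sqrt (2 * pi * p%:R) * L / eps) ^+ 2)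
     <= T%:R)
  (hTc0 : (8 * (Num.sqrt 2 + 1) * Num.sqrt (2 * pi * p%:R) * c0
             / ((1 - Num.sqrt rho) * eps)) ^+ 2 <= T%:R) :
  (\big[mine/+oo]_(0 <= t < T | ~~ odd t)
      'E_P[fun o => enorm (gradient Phi (u t o))] <= eps%:E)%E.
Proof.
have /andP[Lfx0 _] := hLfx.
have [mN TE] : exists m, T = m.+1.*2.
  exists (T./2.-1); rewrite -[LHS]odd_double_half (negbTE hTeven) add0n prednK//.
  by case: (T) hT2 => [|[|t]].
have T2 : T%:R = 2 * mN.+1%:R :> R by rewrite TE -mul2n natrM.
have deltaE k : delta k.*2 = (Num.sqrt (2 * k%:R + 1))^-1.
  by rewrite hdelta ?odd_double// div1r -natr1 -mul2n natrM.
set B := Num.sqrt (2 * pi * p%:R) in heps_cb hT hTc0 *.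
have ppi : 0 < 2 * pi * p%:R :> R by rewrite !mulr_gt0 ?pi_gt0 ?ltr0n.
have B0 : 0 < B by rewrite sqrtr_gt0.
have B2 : B ^+ 2 = 2 * pi * p%:R by rewrite sqr_sqrtr// ltW.
set A := Num.sqrt 2 + 1 in heps_cb hT hTc0.
pose Dl := Phi u0 - Philow.
have D0 : 0 <= Dl by rewrite subr_ge0.
have budget : Dl + L / 2 * (\sum_(k < mN.+1) (2 * k%:R + 1)^-1)
    + c0 * (\sum_(k < mN.+1) rho ^+ k)
    + cb * (\sum_(k < mN.+1) (Num.sqrt (2 * k%:R + 1))^-1)
    < eps / B * \sum_(k < mN.+1) (Num.sqrt (2 * k%:R + 1))^-1.
  move: hT; rewrite ge_max => /andP[hT1 hT3].
  apply: gap_budget_lt => //; rewrite -?T2 -/A.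
  - apply: le_trans hT1; rewrite -/Dl -B2 le_eqVlt; apply/orP; left; apply/eqP.
    by rewrite !exprMn exprVn; ring.
  - apply: le_trans hT3; rewrite le_eqVlt; apply/orP; left; apply/eqP.
    have -> : 8 * pi * p%:R = 4 * B ^+ 2 by rewrite B2; ring.
    have -> : 2 * A * B * L / eps = 2 * A * Num.sqrt (2 * pi * p%:R) * L / eps by [].
    rewrite !exprMn exprVn -/B; ring.
  - apply: le_trans hTc0; rewrite le_eqVlt; apply/orP; left; apply/eqP.
    by congr ((_ / _) ^+ 2); ring.
apply/negbNE/negP; rewrite -ltNge => hmin.
have big_grad k : (k < mN.+1)%N ->
    (eps%:E < \int[P]_o (enorm (gradient Phi (u k.*2 o)))%:E)%E.
  move=> kN; rewrite ltNge; apply/negP => hk.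
  move: hmin; rewrite ltNge => /negP; apply.
  apply: (@bigmin_inf_seq _ _ _ _ _ k.*2).
  - by rewrite mem_index_iota TE/= ltn_double.
  - by rewrite odd_double.
  - by rewrite unlock.
have step k := @expected_step R n p q r hp f h w Psi Lfx Lfu Lhx LPsi (ltW Lfx0) hLfu hLhx
  hLPsi (fun u => hfx u w) (fun x => hfu x w) (hhx w) hPsi hcont Phi L Philow hL hdiff
  hgrad hlow _ Omega P v delta u0 x0 u x y hv hrun k.*2.
have delta0 k : 0 <= delta k.*2 by rewrite deltaE invr_ge0 sqrtr_ge0.
have tel := @telescope_le R (fun k => \int[P]_o (Phi (u k.*2 o) - Philow)%:E)%E
  (fun k => \int[P]_o (enorm (gradient Phi (u k.*2 o)))%:E)%E
  (fun k => delta k.*2 / B)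
  (fun k => L / 2 * delta k.*2 ^+ 2 + (c0 * rho ^+ k + cb * delta k.*2)) mN.+1.
have : ((eps / B * \sum_(k < mN.+1) (Num.sqrt (2 * k%:R + 1))^-1)%:E <=
    (Dl + L / 2 * (\sum_(k < mN.+1) (2 * k%:R + 1)^-1)
    + c0 * (\sum_(k < mN.+1) rho ^+ k)
    + cb * (\sum_(k < mN.+1) (Num.sqrt (2 * k%:R + 1))^-1))%:E)%E.
  apply: (@le_trans _ _ (\sum_(k < mN.+1) ((delta k.*2 / B)%:E *
      \int[P]_o (enorm (gradient Phi (u k.*2 o)))%:E))%E).
    rewrite mulr_sumr -sumEFin; apply: lee_sum => k _.
    rewrite mulrAC [eps * _]mulrC mulrAC -deltaE EFinM; apply: lee_wpmul2l.
      by rewrite lee_fin divr_ge0// ltW.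
    exact/ltW/big_grad.
  apply: le_trans (tel _ _ _ _) _.
  - by move=> k; apply: integral_ge0 => o _; rewrite lee_fin subr_ge0.
  - by move=> k; apply: integral_ge0 => o _; rewrite lee_fin sqrtr_ge0.
  - by move=> k; rewrite divr_ge0// ltW.
  - move=> k; have := step k; rewrite odd_double -/B doubleS => /(_ isT (delta0 k)).
    move/le_trans; apply; rewrite EFinD [leRHS]addeA; apply: leeD => //.
    have := herr k.*2; rewrite odd_double doubleK; exact: (fun H => H isT).
  have -> : (\int[P]_o (Phi (u 0.*2 o) - Philow)%:E = Dl%:E)%E.
    rewrite (eq_integral (cst Dl%:E)); last first.
      by move=> o _; have [[-> _] _ _ _ _] := hrun o.
    by rewrite integral_cst//= probability_setT mule1.
  rewrite -EFinD lee_fin -!addrA !mulr_sumr -!big_split/= le_eqVlt.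
  apply/orP; left; apply/eqP; congr (_ + (_ + _)); apply: eq_bigr => k _.
  by rewrite deltaE exprVn sqr_sqrtr// addr_ge0// mulr_ge0.
by rewrite lee_fin leNgt budget.
Qed.
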